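(* Let $\mathcal C$ be a hereditary graph class with strongly sublinear tree-independence number. Then there exist constants $c\ge 1$ and $\varepsilon>0$ and an algorithm that, given an $n$-vertex graph $G\in\mathcal C$, constructs in time $2^{O(n^{1-\varepsilon})}$ a tree decomposition of $G$ with at most $n$ bags and independence number at most $cn^{1-\varepsilon}$.
   Context: All graphs are finite, simple and nonempty. A graph class is hereditary if it is closed under taking induced subgraphs. The independence number of a tree decomposition of $G$ is the maximum, over its bags $X$, of $\alpha(G[X])$ (where $\alpha$ denotes the independence number of a graph). The tree-independence number $\mathsf{tree}\text{-}\alpha(G)$ is the minimum independence number of a tree decomposition of $G$. A class $\mathcal C$ has strongly sublinear tree-independence number if there exist constants $c'\ge 1$ and $\varepsilon'>0$ such that $\mathsf{tree}\text{-}\alpha(G)\le c'|V(G)|^{1-\varepsilon'}$ for every $G\in\mathcal C$. *)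

(* Defs.v *)
From HB Require Import structures.
From mathcomp Require Import all_boot all_order all_algebra.
From mathcomp Require Import boolp reals exp.

Set Implicit Arguments.
Unset Strict Implicit.
Unset Printing Implicit Defensive.

Import Order.TTheory GRing.Theory Num.Theory.

(** * Graphs *)

(* The carrier may be empty, so that G[X] makes sense for an empty bag X;
   nonemptiness of the graphs of a class is part of [graph_class]. *)
Record sgraph := SGraph {
  vertex :> finType;
  edge : rel vertex;
  edge_sym : symmetric edge;
  edge_irr : irreflexive edge
}.

Section Graphs.
Variable G : sgraph.

Definition induced_edge (X : {set G}) : rel {x : G | x \in X} :=
  fun x y => edge (val x) (val y).

Lemma induced_sym (X : {set G}) : symmetric (@induced_edge X).
Proof. by move=> x y; apply: edge_sym. Qed.

Lemma induced_irr (X : {set G}) : irreflexive (@induced_edge X).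
Proof. by move=> x; apply: edge_irr. Qed.

Definition induced (X : {set G}) : sgraph :=
  SGraph (@induced_sym X) (@induced_irr X).

Definition independent (S : {set G}) : bool :=
  [forall x in S, forall y in S, ~~ edge x y].

Definition alpha : nat := \max_(S : {set G} | independent S) #|S|.

Definition connected : Prop := forall x y : G, connect (@edge G) x y.

(* [2 < size p]: in mathcomp [:: x; y] is a [ucycle] for every edge xy. *)
Definition acyclic : Prop :=
  forall p : seq G, 2 < size p -> ~ ucycle (@edge G) p.

Definition is_tree : Prop := [/\ 0 < #|G|, connected & acyclic].

End Graphs.

Definition isomorphic (G H : sgraph) : Prop :=
  exists2 f : G -> H, bijective f & {mono f : x y / edge x y}.

(** * Tree decompositions *)

Record tree_decomp (G : sgraph) := TreeDecomp {
  td_tree : sgraph;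
  td_bag : td_tree -> {set G};
  td_treeP : is_tree td_tree;
  td_vertexP : forall v : G, exists t, v \in td_bag t;
  td_edgeP : forall u v : G, edge u v ->
    exists t, (u \in td_bag t) && (v \in td_bag t);
  td_connP : forall v : G, connected (induced [set t | v \in td_bag t])
}.

Arguments td_bag {G} D t : rename.

Definition td_alpha (G : sgraph) (D : tree_decomp G) : nat :=
  \max_(t : td_tree D) alpha (induced (td_bag D t)).

Section TrivialDecomposition.
Variable G : sgraph.

Let norel : rel unit := fun _ _ => false.
Let norel_sym : symmetric norel. Proof. by []. Qed.
Let norel_irr : irreflexive norel. Proof. by []. Qed.
Let point : sgraph := SGraph norel_sym norel_irr.

Lemma point_tree : is_tree point.
Proof.
split; first by rewrite card_unit.
  by move=> [] []; apply: connect0.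
by move=> [|[] [|[] p]].
Qed.

Definition trivial_decomp : tree_decomp G.
Proof.
exists point (fun=> [set: G]).
- exact: point_tree.
- by move=> v; exists tt; rewrite inE.
- by move=> u v _; exists tt; rewrite !inE.
- move=> v [[] x] [[] y]; have -> : x = y by exact: bool_irrelevance.
  exact: connect0.
Defined.

Lemma td_alpha_exists :
  exists k : nat, `[< exists D : tree_decomp G, td_alpha D = k >].
Proof. by exists (td_alpha trivial_decomp); apply/asboolP; exists trivial_decomp. Qed.

End TrivialDecomposition.

Definition tree_alpha (G : sgraph) : nat := ex_minn (td_alpha_exists G).

(** * Graph classes *)

Definition graph_class (C : sgraph -> Prop) : Prop :=
  (forall G, C G -> 0 < #|G|) /\
  (forall G H, isomorphic G H -> C G -> C H).

Definition hereditary (C : sgraph -> Prop) : Prop :=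
  forall (G : sgraph) (X : {set G}), X != set0 -> C G -> C (induced X).

Definition strongly_sublinear_tree_alpha (R : realType) (C : sgraph -> Prop)
    : Prop :=
  exists c' eps' : R, [/\ (1 <= c')%R, (0 < eps')%R &
    forall G, C G ->
      ((tree_alpha G)%:R <= c' * (#|G|%:R `^ (1 - eps')))%R].

(** * Algorithms *)

(* Algorithms are programs of a first-order call-by-value functional language
   whose only data are binary trees (pure Lisp; cf. the languages WHILE and F
   of N. Jones, Computability and Complexity).  A program is a list of
   mutually recursive unary functions, and each application of an evaluation
   rule costs one unit of time.  Every rule performs a bounded number of
   pointer operations and allocates at most one cell, so this time measure is
   polynomially related to that of Turing machines and random access
   machines. *)

Inductive data : Type := Nil | Cons of data & data.

(* Variables are de Bruijn indices. *)
Inductive term : Type :=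
  | TVar of nat
  | TNil
  | TCons of term & term
  | TLet of term & term           (* binds variable 0 in the second term *)
  | TCase of term & term & term   (* nil branch; cons branch, in which
                                     variables 0 and 1 are head and tail *)
  | TCall of nat & term.          (* function number, argument *)

Definition program := seq term.

(* [eval p s e v t]: in the environment s, e evaluates to v in time t. *)
Inductive eval (p : program) : seq data -> term -> data -> nat -> Prop :=
  | EVar s i : eval p s (TVar i) (nth Nil s i) 1
  | ENil s : eval p s TNil Nil 1
  | ECons s e1 e2 v1 v2 t1 t2 :
      eval p s e1 v1 t1 -> eval p s e2 v2 t2 ->
      eval p s (TCons e1 e2) (Cons v1 v2) (t1 + t2).+1
  | ELet s e1 e2 v1 v2 t1 t2 :
      eval p s e1 v1 t1 -> eval p (v1 :: s) e2 v2 t2 ->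
      eval p s (TLet e1 e2) v2 (t1 + t2).+1
  | ECaseNil s e e0 e1 v t1 t2 :
      eval p s e Nil t1 -> eval p s e0 v t2 ->
      eval p s (TCase e e0 e1) v (t1 + t2).+1
  | ECaseCons s e e0 e1 a b v t1 t2 :
      eval p s e (Cons a b) t1 -> eval p (a :: b :: s) e1 v t2 ->
      eval p s (TCase e e0 e1) v (t1 + t2).+1
  | ECall s f e v w t1 t2 :
      eval p s e v t1 -> eval p [:: v] (nth TNil p f) w t2 ->
      eval p s (TCall f e) w (t1 + t2).+1.

Lemma eval_deterministic p s e v t v' t' :
  eval p s e v t -> eval p s e v' t' -> v = v' /\ t = t'.
Proof.
move=> ev; elim: ev v' t' => {s e v t}; intros;
  match goal with H : eval _ _ _ ?v _ |- _ = ?v /\ _ => inversion H end; subst;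
  repeat match goal with
  | IH : (forall v t, eval p ?s ?e v t -> _), H : eval p ?s ?e _ _ |- _ =>
      case: (IH _ _ H) => ? ?; clear H; try discriminate;
      try match goal with E : Cons _ _ = Cons _ _ |- _ => case: E => ? ? end;
      subst
  end; by [].
Qed.

(* Function 0 is the entry point. *)
Definition runs (p : program) (x y : data) (t : nat) : Prop :=
  eval p [:: x] (nth TNil p 0) y t.

Definition code_bool (b : bool) : data := if b then Cons Nil Nil else Nil.

Definition code_seq (T : Type) (code : T -> data) (s : seq T) : data :=
  foldr (fun x d => Cons (code x) d) Nil s.

(* A set is coded by its characteristic bit vector, a graph by its adjacency
   matrix, and a tree decomposition by the code of its tree together with the
   list of its bags; vertices and nodes are ordered by [enum].  Since the
   vertex type is arbitrary, every labelling of a graph is the [enum] order of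
   some isomorphic copy. *)
Definition code_set (T : finType) (X : {set T}) : data :=
  code_seq (fun x => code_bool (x \in X)) (enum T).

Definition code_graph (G : sgraph) : data :=
  code_seq (fun x => code_set [set y | edge x y]) (enum G).

Definition code_decomp (G : sgraph) (D : tree_decomp G) : data :=
  Cons (code_graph (td_tree D))
       (code_seq (fun t => code_set (td_bag D t)) (enum (td_tree D))).

(* Main.v *)
From Pilot Require (* [Nil] and [Cons] denote the constructors of [data] from here on. *)
Import Defs.
From HB Require Import structures.
From mathcomp Require Import all_boot all_order all_algebra.
From mathcomp Require Import boolp reals exp.
From mathcomp Require Import zify ring lra.

Set Implicit Arguments.
Unset Strict Implicit.
Unset Printing Implicit Defensive.

Import Order.TTheory GRing.Theory Num.Theory.
(* [Nil] and [Cons] denote the constructors of [data] from here on. *)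
Import Defs.

(** Balanced separators of small independence number exist.  In a graph of the
    class with vertex set [K], some bag [X] of an optimal tree decomposition
    leaves only components with at most half of the vertices ([balanced_bag]).
    By heredity this holds for every induced subgraph, so separating
    recursively gives a decomposition whose bags are unions of separators of
    graphs that shrink by half each time; their independence numbers, each
    sublinear in the size of the graph, then add up to a geometric series.

    The difficulty is to find a separator: [X] may be a large clique, so the
    sets of independence number at most [k] are too many to be listed.  They
    are replaced by containers, as in the graph container method.  Fix [s] and
    run through all vertex sets [J] with [s] elements; whenever [J] is
    independent and contained in the current candidate set [U], discard from
    [U] the vertices of [J] outside a fingerprint [F].  If [F] has fewer than
    [s] elements, what survives has independence number below [s]
    ([alpha_container]).  If [F] collects the vertices of [X] that are met on
    the way, nothing of [X] is discarded; each round discards at least [s - k]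
    vertices and costs at most [k] elements of [F], so [F] has fewer than [s]
    elements as soon as [k * #|K| < s * (s - k)]
    ([container_fingerprint]).  As supersets of balanced separators are
    balanced, it suffices to try the [n^O(s)] fingerprints for
    [s = 0, 1, 2, ...] until a container is balanced.  With
    [k = O(n^(1 - e))] this succeeds at some [s = O(n^(1 - e / 2))]
    ([sep_size_large]), within time [n^O(s)], which is [2^O(n^(1 - e / 4))]
    ([runtime_bound]).  The search needs no knowledge of the constants, so one
    and the same program serves all classes.

    The bags are produced as a path decomposition: with [U] a separator of a
    component [C] of the rest [W] and [B] the union of the separators around
    it, emit the bag [U :|: B], then the bags for [C :\: U] with [U] added to
    [B], then the bags for [W :\: C] ([layout_cons], [decompose_set]).  Every
    bag consumes the vertices of a nonempty separator, hence there are at most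
    [n] of them. *)

(** * Connected components and independence in vertex sets *)

Lemma independentP (G : sgraph) (A : {set G}) :
  reflect {in A &, forall x y, ~~ edge x y} (independent A).
Proof.
apply: (iffP forall_inP) => [I x y xA yA|I x xA].
  by have /forall_inP := I x xA; apply.
by apply/forall_inP => y yA; apply: I.
Qed.

Section VertexSets.
Variable G : sgraph.
Implicit Types (u v w : G) (K W U X Z A B C F J : {set G}).

Definition nbrs A : {set G} := [set y | [exists x in A, edge x y]].

Definition comp_step v W A : {set G} := v |: (nbrs A :&: W).

(** The component of [v] in [G[W]], as a least fixed point: [fixset] iterates
   the step [#|G|] times from the empty set, which the program can imitate. *)
Definition comp v W : {set G} := fixset (comp_step v W).

Lemma nbrsP A y : reflect (exists2 x, x \in A & edge x y) (y \in nbrs A).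
Proof. by rewrite inE; apply: (iffP exists_inP). Qed.

Lemma nbrsS A B : A \subset B -> nbrs A \subset nbrs B.
Proof.
by move=> /subsetP AB; apply/subsetP => y /nbrsP[x /AB xB xy]; apply/nbrsP; exists x.
Qed.

Lemma comp_step_mono v W : {homo comp_step v W : A B / A \subset B}.
Proof. by move=> A B AB; rewrite setUS // setSI // nbrsS. Qed.

Lemma comp_fix v W : comp_step v W (comp v W) = comp v W.
Proof. by apply: fixsetK; apply: comp_step_mono. Qed.

Lemma mem_comp v W : v \in comp v W.
Proof. by rewrite -comp_fix setU11. Qed.

Lemma comp_closed v W x y :
  x \in comp v W -> edge x y -> y \in W -> y \in comp v W.
Proof.
move=> xC xy yW; rewrite -comp_fix !inE yW andbT orbC.
by apply/orP; left; apply/exists_inP; exists x.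
Qed.

(** The induction principle for reachability: together with [comp_closed] it
   spares all reasoning about paths in [G]. *)
Lemma comp_min v W Z : v \in Z ->
  (forall x y, x \in Z -> edge x y -> y \in W -> y \in Z) -> comp v W \subset Z.
Proof.
move=> vZ clZ; rewrite /comp /fixset; elim: #|G| => [|m IHm]; first exact: sub0set.
apply/subsetP => y; rewrite /= !inE => /orP[/eqP -> //|/andP[]].
by case/exists_inP => x /(subsetP IHm) xZ xy yW; apply: clZ xy yW.
Qed.

Lemma comp_sub v W : v \in W -> comp v W \subset W.
Proof. by move=> vW; apply: comp_min. Qed.

Lemma compS v W W' : W \subset W' -> comp v W \subset comp v W'.
Proof.
move=> /subsetP WW'; apply: comp_min => [|x y xC xy yW]; first exact: mem_comp.
by apply: comp_closed xC xy _; apply: WW'.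
Qed.

Lemma comp_trans v W u : u \in comp v W -> comp u W \subset comp v W.
Proof. by move=> uC; apply: comp_min => // x y; apply: comp_closed. Qed.

Lemma comp_idem v W : comp v (comp v W) = comp v W.
Proof.
apply/eqP; rewrite eqEsubset comp_sub ?mem_comp //=.
suff /subsetP S : comp v W \subset [set x in comp v W | x \in comp v (comp v W)].
  by apply/subsetP => x /S; rewrite inE => /andP[].
apply: comp_min => [|x y]; first by rewrite inE !mem_comp.
rewrite !inE => /andP[xC xCC] xy yW.
have yC := comp_closed xC xy yW.
by rewrite yC (comp_closed xCC xy yC).
Qed.

(** No edge of [G[W]] joins two components, so those that remain are not cut. *)
Lemma comp_setD u v W : u \in W -> v \in W :\: comp u W ->
  comp v (W :\: comp u W) = comp v W.
Proof.
move=> uW vW; apply/eqP; rewrite eqEsubset compS ?subsetDl //=.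
apply: comp_min => [|x y xC xy yW]; first exact: mem_comp.
apply: (comp_closed xC xy); rewrite in_setD yW andbT.
have := subsetP (comp_sub vW) _ xC; rewrite in_setD => /andP[xNC xW].
by apply: contra xNC => yC; apply: comp_closed yC _ xW; rewrite edge_sym.
Qed.

Definition alpha_set X : nat :=
  \max_(S : {set G} | (S \subset X) && independent S) #|S|.

Lemma independentS A B : A \subset B -> independent B -> independent A.
Proof.
by move=> /subsetP AB /independentP I; apply/independentP => x y /AB xB /AB; apply: I.
Qed.

Lemma alpha_set_geq X A : A \subset X -> independent A -> #|A| <= alpha_set X.
Proof.
by move=> AX iA; apply: (bigop.bigmax_sup A); rewrite ?AX.
Qed.

Lemma alpha_set_leP X k :
  (forall A, A \subset X -> independent A -> #|A| <= k) -> alpha_set X <= k.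
Proof. by move=> H; apply/bigmax_leqP => A /andP[]; apply: H. Qed.

Lemma alpha_setU A B : alpha_set (A :|: B) <= alpha_set A + alpha_set B.
Proof.
apply: alpha_set_leP => S SAB iS; rewrite -(cardsID A S) leq_add //.
  by apply: alpha_set_geq (independentS _ iS); rewrite ?subsetIr ?subsetIl.
apply: alpha_set_geq (independentS _ iS); rewrite ?subsetDl //.
by rewrite subDset.
Qed.

Lemma alpha_set0 : alpha_set set0 = 0.
Proof.
by apply/eqP; rewrite -leqn0; apply: alpha_set_leP => S; rewrite subset0 => /eqP->; rewrite cards0.
Qed.

Lemma alpha_induced X : alpha (induced X) = alpha_set X.
Proof.
apply/eqP; rewrite eqn_leq; apply/andP; split.
  apply/bigmax_leqP => S iS.
  have -> : #|S| = #|val @: S| by rewrite card_imset //; apply: val_inj.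
  apply: alpha_set_geq.
    by apply/subsetP => _ /imsetP[x _ ->]; apply: valP.
  apply/independentP => _ _ /imsetP[x xS ->] /imsetP[y yS ->].
  exact: (independentP _ iS).
apply: alpha_set_leP => S SX iS.
have -> : #|S| = #|[set x : induced X | val x \in S]|.
  rewrite -(card_imset _ (@val_inj _ _ _)); apply: eq_card => x.
  apply/idP/imsetP => [xS|[y]]; last by rewrite inE => ? ->.
  by exists (Sub x (subsetP SX x xS)); rewrite // inE.
apply: bigop.bigmax_sup (leqnn _).
by apply/forall_inP => x; rewrite inE => xS; apply/forall_inP => y; rewrite inE => yS; apply: (independentP _ iS).
Qed.

(** That a component has at most half of the vertices of [K] is stated by
   comparing it with its complement, because this is what the program does. *)
Definition balanced K U : bool :=
  [forall v in K :\: U, #|comp v (K :\: U)| <= #|K :\: comp v (K :\: U)|].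

Lemma half_leq K C : C \subset K -> (#|C| <= #|K :\: C|) = (#|C|.*2 <= #|K|).
Proof. by move=> CK; have := cardsID C K; rewrite (setIidPr CK); lia. Qed.

Lemma balancedP K U :
  reflect (forall v, v \in K :\: U -> #|comp v (K :\: U)|.*2 <= #|K|) (balanced K U).
Proof.
apply: (iffP forall_inP) => H v vKU; have := H v vKU; rewrite half_leq //;
  exact: subset_trans (comp_sub vKU) (subsetDl _ _).
Qed.

Lemma balancedS K U X : X \subset U -> balanced K X -> balanced K U.
Proof.
move=> XU /balancedP bX; apply/balancedP => v vKU.
have sub : K :\: U \subset K :\: X by rewrite setDS.
have := bX v (subsetP sub v vKU); apply: leq_trans.
by rewrite leq_double subset_leq_card // compS.
Qed.

Lemma balanced_neq0 v W U : balanced (comp v W) U -> U != set0.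
Proof.
move=> /balancedP b; apply/eqP => U0; move: (b v).
rewrite U0 setD0 comp_idem mem_comp => /(_ isT).
have : 0 < #|comp v W| by apply/card_gt0P; exists v; apply: mem_comp.
by lia.
Qed.

(** * Containers for sets of small independence number *)

(** The process of the graph container method, with fingerprint [F].  The
   condition says that [J] is an independent subset of [U]
   ([sub_nbrs_indep]). *)
Fixpoint container F (Js : seq {set G}) U : {set G} :=
  if Js is J :: Js' then
    container F Js' (if J \subset U :\: nbrs J then U :\: (J :\: F) else U)
  else U.

Lemma sub_nbrs_indep U J : (J \subset U :\: nbrs J) = (J \subset U) && independent J.
Proof.
rewrite subsetD; congr (_ && _); apply/pred0P/independentP => [H x y xJ yJ|H y].
  apply/negP => xy; have := H y; rewrite /= yJ => /negP; apply; apply/nbrsP; by exists x.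
apply/negP => /andP[yJ /nbrsP[x xJ xy]]; by have := H x y xJ yJ; rewrite xy.
Qed.

Lemma container_sub F Js U : container F Js U \subset U.
Proof.
elim: Js U => //= J Js IH U; apply: subset_trans (IH _) _.
by case: ifP => // _; apply: subsetDl.
Qed.

(** An independent set of size [s] that survives was scanned when it was
   contained in the candidate set, so it lies inside the fingerprint, which is
   too small for it. *)
Lemma alpha_container F (Js : seq {set G}) U s : #|F| < s ->
  (forall J, J \subset U -> #|J| = s -> J \in Js) ->
  alpha_set (container F Js U) < s.
Proof.
move=> Fs allJ.
have noJ J : J \in Js -> #|J| = s -> independent J -> ~~ (J \subset container F Js U).
  move=> + cJ iJ; elim: Js U {allJ} => //= J' Js IH U; rewrite inE.
  have [<- _|_ /= /IH] := eqVneq J J'; last by apply.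
  rewrite sub_nbrs_indep iJ andbT; apply/negP => JC.
  have := subset_trans JC (container_sub _ _ _); case: ifP => [JU|->//].
  move=> /subsetP JUF; have : J \subset F.
    by apply/subsetP => x xJ; move: (JUF x xJ); rewrite !inE xJ; case: (x \in F).
  by move/subset_leq_card; rewrite cJ leqNgt Fs.
rewrite ltnNge; apply/negP => big.
have ne : 0 < #|[pred S : {set G} | (S \subset container F Js U) && independent S]|.
  by apply/card_gt0P; exists set0; rewrite inE sub0set /=; apply/independentP => x y; rewrite inE.
have [S /andP[SC iS] cS] := eq_bigmax_cond (fun S : {set G} => #|S|) ne.
have {cS} cS : alpha_set (container F Js U) = #|S| := cS.
rewrite cS in big.
have [J JS cJ] : exists2 J : {set G}, J \subset S & #|J| = s.
  move: big; rewrite -bin_gt0 -cards_draws => /card_gt0P[J].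
  by rewrite inE => /andP[JS /eqP cJ]; exists J.
have JC := subset_trans JS SC.
have := noJ J (allJ J (subset_trans JC (container_sub _ _ _)) cJ) cJ (independentS JS iS).
by rewrite JC.
Qed.

(** [F] collects [J :&: X] over the sets [J] that cause a deletion.  Then every
   deletion removes [J :\: X], which spares [X]; it has at least [s - k]
   elements, against at most [k] that are added to [F].  The final quantifier
   over [F'] lets the induction enlarge [F] without changing earlier
   deletions. *)
Lemma container_fingerprint X k s (Js : seq {set G}) U :
  alpha_set X <= k -> k < s -> (forall J, J \in Js -> #|J| = s) -> X \subset U ->
  exists F, [/\ F \subset X, #|F| * (s - k) <= k * #|U| &
    forall F', F \subset F' -> F' \subset X -> X \subset container F' Js U].
Proof.
move=> aX ks; elim: Js U => [|J Js IH] U cJs XU.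
  by exists set0; split; rewrite ?sub0set ?cards0.
have cJs' J' : J' \in Js -> #|J'| = s by move=> J'J; apply: cJs; rewrite inE J'J orbT.
have cJ : #|J| = s by apply: cJs; rewrite inE eqxx.
case: (boolP (J \subset U :\: nbrs J)) => fire; last first.
  by have [F [FX cF HF]] := IH U cJs' XU; exists F; split => //= F'; rewrite (negbTE fire); apply: HF.
move: (fire); rewrite sub_nbrs_indep => /andP[JU iJ].
have cJX : #|J :&: X| <= k.
  by apply: leq_trans aX; apply: alpha_set_geq (independentS _ iJ); rewrite ?subsetIl ?subsetIr.
have XU' : X \subset U :\: (J :\: X).
  by apply/subsetP => x xX; rewrite !inE xX (subsetP XU).
have [F [FX cF HF]] := IH _ cJs' XU'; exists (F :|: (J :&: X)); split.
- by rewrite subUset FX subsetIr.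
- have cU' : #|U :\: (J :\: X)| + (s - k) <= #|U|.
    rewrite -(cardsID (J :\: X) U) addnC leq_add2r.
    have /setIidPr -> : J :\: X \subset U := subset_trans (subsetDl _ _) JU.
    by move: (cardsID X J); rewrite cJ; lia.
  have cFJ : #|F :|: (J :&: X)| <= #|F| + k.
    by rewrite (leq_trans (leq_card_setU _ _).1) // leq_add2l.
  have : (#|F| + k) * (s - k) <= k * #|U|.
    rewrite mulnDl; apply: leq_trans (leq_add cF (leqnn _)) _.
    by rewrite -mulnDr leq_mul2l cU' orbT.
  by apply: leq_trans; rewrite leq_mul2r cFJ orbT.
- move=> F'; rewrite subUset => /andP[FF' JF'] F'X /=; rewrite fire.
  suff -> : U :\: (J :\: F') = U :\: (J :\: X) by apply: HF.
  congr (_ :\: _); apply/setP => x; rewrite !inE.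
  case xJ: (x \in J); rewrite ?andbF ?andbT //; congr (~~ _); apply/idP/idP.
    exact: (subsetP F'X).
  by move=> xX; apply: (subsetP JF'); rewrite inE xJ.
Qed.

End VertexSets.

(** * Balanced bags *)

Section Trees.
Variable T : sgraph.
Implicit Types (t x y z : T).

(** Adjacency in the tree with the node [t] deleted. *)
Definition off t : rel T := fun x y => [&& edge x y, x != t & y != t].

Lemma off_sym t : connect_sym (off t).
Proof.
by apply: sym_connect_sym => x y; rewrite /off edge_sym [(x != t) && _]andbC.
Qed.

Lemma off_avoids t x p : path (off t) x p -> t \notin p.
Proof.
elim: p x => //= y p IH x /andP[/and3P[_ _ yt] /IH]; rewrite inE negb_or => ->.
by rewrite andbT eq_sym.
Qed.

Lemma off_edge t x p : path (off t) x p -> path (@edge T) x p.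
Proof. by apply: sub_path => u v /and3P[]. Qed.

(** Two neighbours of [t] joined by a path that avoids [t] would close a cycle
   through [t]. *)
Lemma tree_side_nbr t x y : is_tree T -> edge t x -> edge t y ->
  connect (off t) x y -> x = y.
Proof.
move=> [_ _ acyc] tx ty /connectP[p0 /shortenP[p pth up _] lst].
apply/eqP; apply/negPn/negP => xy.
have cyc : ucycle (@edge T) (t :: x :: p).
  rewrite /ucycle /= tx rcons_path (off_edge pth) -lst edge_sym ty -/(uniq (x :: p)) up.
  rewrite inE negb_or (off_avoids pth) andbT /=.
  by rewrite !andbT; apply/eqP => t_x; rewrite t_x edge_irr in tx.
case: p => [|z p] in pth up lst cyc *; first by rewrite lst eqxx in xy.
exact: acyc cyc.
Qed.

Lemma first_step (e : rel T) x y : x != y -> connect e x y ->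
  exists2 z, e x z & exists p, [/\ path e z p, x \notin z :: p & y = last z p].
Proof.
move=> xy /connectP[p0 /shortenP[[|z p] /= pth up _] lst].
  by rewrite lst eqxx in xy.
move: pth up => /andP[xz pth] /andP[xzp _].
by exists z => //; exists p; split.
Qed.

Lemma path_off t x p : t \notin x :: p -> path (@edge T) x p -> connect (off t) x (last x p).
Proof.
move=> + pth; elim: p x pth => [|y p IH] x /=; first by rewrite connect0.
move=> /andP[xy pth]; rewrite inE negb_or eq_sym => /andP[xt typ].
apply: connect_trans (IH y pth typ); apply: connect1.
by rewrite /off xy xt /=; move: typ; rewrite inE negb_or eq_sym => /andP[].
Qed.

End Trees.

Section BalancedBag.
Variables (G T : sgraph) (bag : T -> {set G}) (K : {set G}).
Hypothesis treeT : is_tree T.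
Hypothesis bag_vertex : forall v, v \in K -> exists t, v \in bag t.
Hypothesis bag_edge : forall u v, u \in K -> v \in K -> edge u v ->
  exists t, (u \in bag t) && (v \in bag t).
Hypothesis bag_conn : forall v t x y, v \in K -> v \notin bag t ->
  v \in bag x -> v \in bag y -> connect (off t) x y.

(** The component avoids [bag t], so the nodes that meet it form a connected
   part of the tree without [t]. *)
Lemma comp_side t v y : v \in K :\: bag t -> v \in bag y ->
  forall w x, w \in comp v (K :\: bag t) -> w \in bag x -> connect (off t) y x.
Proof.
move=> vKt vy w x wC wx.
pose Z := [set w in K :\: bag t | [forall x, (w \in bag x) ==> connect (off t) y x]].
suff /subsetP/(_ w wC) : comp v (K :\: bag t) \subset Z.
  by rewrite inE => /andP[_ /forallP/(_ x)]; rewrite wx.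
have inK u : u \in K :\: bag t -> (u \in K) /\ (u \notin bag t) by rewrite inE => /andP[].
apply: comp_min => [|a b].
  rewrite inE vKt; apply/forall_inP => z vz.
  by have [vK vt] := inK v vKt; apply: bag_conn vK vt vy vz.
rewrite inE => /andP[aKt /forall_inP aZ] ab bKt.
have [aK _] := inK a aKt; have [bK bt] := inK b bKt.
have [s /andP[as_ bs]] := bag_edge aK bK ab.
rewrite inE bKt; apply/forall_inP => z bz.
exact: connect_trans (aZ s as_) (bag_conn bK bt bs bz).
Qed.

(** If no bag were balanced, every node [t] would have a large component, whose
   nodes lie on one side of [t].  Choose [t] with this side as small as
   possible and let [t'] be the neighbour of [t] in it.  The large components
   of [t] and [t'] meet, as each has more than half of the vertices; hence the
   side of [t'] cannot lie towards [t], and it is strictly smaller. *)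
Lemma balanced_bag : exists t, balanced K (bag t).
Proof.
have [t bt|unb] := pickP (fun t => balanced K (bag t)); first by exists t.
exfalso.
have big t : exists w : G * T, [&& w.1 \in K :\: bag t, w.1 \in bag w.2 &
    #|K| < #|comp w.1 (K :\: bag t)|.*2].
  have /negP nb := negbT (unb t).
  have [v vK cv] : exists2 v, v \in K :\: bag t & #|K| < #|comp v (K :\: bag t)|.*2.
    have [v /andP[]|H] := pickP [pred v in K :\: bag t | #|K| < #|comp v (K :\: bag t)|.*2].
      by exists v.
    by case: nb; apply/balancedP => v vK; rewrite leqNgt; have /= := H v; rewrite vK /= => ->.
  have [y vy] := bag_vertex (subsetP (subsetDl _ _) v vK).
  by exists (v, y); rewrite /= vK vy.
pose wit t := xchoose (big t).
pose side t := [set z | connect (off t) (wit t).2 z].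
have witP t : [/\ (wit t).1 \in K :\: bag t, (wit t).1 \in bag (wit t).2 &
    #|K| < #|comp (wit t).1 (K :\: bag t)|.*2] by apply/and3P; apply: xchooseP (big t).
have side_comp t w x : w \in comp (wit t).1 (K :\: bag t) -> w \in bag x -> x \in side t.
  by have [w1 w2 _] := witP t; rewrite inE; apply: comp_side w1 w2 w x.
have off_end t x y : connect (off t) x y -> y = x \/ y != t.
  move=> /connectP[p pth ->]; case/lastP: p pth => [|p z] /=; first by left.
  by rewrite rcons_path last_rcons => /andP[_ /and3P[]]; right.
have notin_side t : t \notin side t.
  rewrite inE; apply/negP => /off_end[tw|/eqP//].
  by have [w1 w2 _] := witP t; rewrite -tw in w2; move: w1; rewrite inE w2.
have [t0 _] : exists t : T, true by have [/card_gt0P[t _] _ _] := treeT; exists t.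
have [t _ tmin] := @arg_minnP _ t0 predT (fun t => #|side t|) isT.
have twit : t != (wit t).2.
  apply: contra (notin_side t) => /eqP tw; by rewrite inE -tw connect0.
have [_ connT _] := treeT.
have [t' tt' [p [pth tp lst]]] := first_step twit (connT t (wit t).2).
have t'_side : t' \in side t by rewrite inE off_sym lst path_off.
have t't : t' != t by move: tp; rewrite inE negb_or eq_sym => /andP[].
have [w wC wC'] : exists2 w, w \in comp (wit t).1 (K :\: bag t) &
    w \in comp (wit t').1 (K :\: bag t').
  have [k1 _ b1] := witP t; have [k2 _ b2] := witP t'.
  have := subset_trans (comp_sub k1) (subsetDl _ _); have := subset_trans (comp_sub k2) (subsetDl _ _).
  move: (comp _ _) (comp _ _) b1 b2 => A B cA cB BK AK.
  have : 0 < #|A :&: B|.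
    have := subset_leq_card (_ : A :|: B \subset K); rewrite subUset AK BK => /(_ isT).
    by have := cardsUI A B; lia.
  by move=> /card_gt0P[w]; rewrite inE => /andP[]; exists w.
have [k1 _ _] := witP t.
have wK : w \in K by have := subsetP (comp_sub k1) w wC; rewrite inE => /andP[].
have [y wy] := bag_vertex wK.
have y_side : y \in side t := side_comp _ _ _ wC wy.
have y_side' : y \in side t' := side_comp _ _ _ wC' wy.
(* Otherwise the first step from [t] to [y] would lead to a second neighbour
   of [t] in [side t]. *)
have t_side' : t \notin side t'.
  apply/negP => ts'.
  have yt : t != y by apply: contra (notin_side t) => /eqP {1}->.
  have cty : connect (off t') t y.
    by apply: connect_trans (_ : connect _ (wit t').2 _); [rewrite off_sym; move: ts'|move: y_side']; rewrite inE.
  have [x /and3P[tx _ xt'] [q [pthq tq lstq]]] := first_step yt cty.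
  have : t' = x.
    apply: tree_side_nbr treeT tt' tx _.
    apply: connect_trans (_ : connect _ (wit t).2 _).
      by rewrite off_sym; move: t'_side; rewrite inE.
    apply: connect_trans (_ : connect _ y _); first by move: y_side; rewrite inE.
    by rewrite off_sym lstq path_off // (off_edge pthq).
  by move=> t'x; rewrite t'x eqxx in xt'.
have : #|side t'| < #|side t|.
  apply: proper_card; apply/properP; split; last by exists t' => //; apply: notin_side.
  apply/subsetP => z; rewrite inE => cz.
  have yz : connect (off t') y z.
    by apply: connect_trans cz; rewrite off_sym; move: y_side'; rewrite inE.
  have stay : forall q u, u \in side t' -> path (off t') u q -> path (off t) u q.
    elim=> //= a q IH u us' /andP[ua /IH pa].
    have as' : a \in side t' by move: us'; rewrite !inE => /connect_trans; apply; apply: connect1.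
    rewrite pa // andbT; move: ua => /and3P[ua _ _]; rewrite /off ua.
    by rewrite (contraNneq _ t_side') ?(contraNneq _ t_side') // => <-.
  move: yz => /connectP[q pthq ->]; have := stay q y y_side' pthq => pq.
  move: y_side; rewrite !inE => /connect_trans; apply; apply/connectP; by exists q.
by rewrite ltnNge tmin.
Qed.

End BalancedBag.

Lemma decomp_balanced_bag (G : sgraph) (K : {set G}) (D : tree_decomp (induced K)) :
  exists2 X : {set G}, X \subset K & balanced K X /\ alpha_set X <= td_alpha D.
Proof.
pose bag t : {set G} := val @: td_bag D t.
have bagE v t (vK : v \in K) : (v \in bag t) = (Sub v vK \in td_bag D t).
  apply/imsetP/idP => [[x xt vx]|vt]; last by exists (Sub v vK).
  by rewrite (_ : Sub v vK = x) //; apply: val_inj.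
have [||||t bt] := @balanced_bag G (td_tree D) bag K.
- exact: td_treeP.
- by move=> v vK; have [t vt] := td_vertexP D (Sub v vK); exists t; rewrite bagE.
- move=> u v uK vK uv.
  have [t /andP[ut vt]] := td_edgeP D (uv : edge (Sub u uK : induced K) (Sub v vK)).
  by exists t; rewrite !bagE ut.
- move=> v t x y vK; rewrite !bagE => vt vx vy.
  pose S := [set s | Sub v vK \in td_bag D s].
  have Sx : x \in S by rewrite inE.
  have Sy : y \in S by rewrite inE.
  have := @td_connP _ D (Sub v vK) (Sub x Sx : induced S) (Sub y Sy : induced S).
  move=> /connectP[p pth lst].
  have -> : y = last x (map val p) by rewrite -[x]/(val (Sub x Sx : induced S)) last_map -lst.
  apply: path_off; last by rewrite -[x]/(val (Sub x Sx : induced S)) path_map.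
  rewrite -[x]/(val (Sub x Sx : induced S)) -map_cons; apply/negP => /mapP[s _ ts].
  by have : val s \in S := valP s; rewrite inE -ts (negbTE vt).
exists (bag t); first by apply/subsetP => _ /imsetP[x _ ->]; apply: valP.
split=> //; apply: leq_trans (leq_bigmax t).
apply/bigmax_leqP => S /andP[St iS].
apply: (bigop.bigmax_sup [set x : induced (td_bag D t) | val (val x) \in S]).
  apply/independentP => x y; rewrite !inE => xS yS.
  exact: (independentP _ iS _ _ xS yS).
rewrite -(card_imset _ (inj_comp val_inj val_inj)); apply: subset_leq_card.
apply/subsetP => v vS; have := subsetP St v vS => /imsetP[x xt vx].
by apply/imsetP; exists (Sub x xt : induced (td_bag D t)); rewrite //= inE /= -vx.
Qed.

(** * The program *)

(** Programs are written with the binders of the metalanguage.  An [hterm] is a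
   term that awaits the number of variables in scope; a variable is known by
   its de Bruijn level, from which that number recovers its index. *)
Definition hterm := nat -> term.
Definition hvar (l : nat) : hterm := fun d => TVar (d - l.+1).
Definition hnil : hterm := fun _ => TNil.
Definition hcons (e1 e2 : hterm) : hterm := fun d => TCons (e1 d) (e2 d).
Definition hlet (e : hterm) (f : hterm -> hterm) : hterm :=
  fun d => TLet (e d) (f (hvar d) d.+1).
Definition hcase (e e0 : hterm) (f : hterm -> hterm -> hterm) : hterm :=
  fun d => TCase (e d) (e0 d) (f (hvar d.+1) (hvar d) d.+2).
Definition hcall (f : nat) (e : hterm) : hterm := fun d => TCall f (e d).
Definition hfun (f : hterm -> hterm) : term := f (hvar 0) 1.

Declare Scope prog_scope.
Delimit Scope prog_scope with P.
Local Notation "x ,, y" := (hcons x y) (at level 61, right associativity) : prog_scope.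
Local Notation "f @ x" := (hcall f x) (at level 10, x at level 8) : prog_scope.
Local Notation "'bind' x := e 'in' f" := (hlet e (fun x => f))
  (at level 200, x name, f at level 200) : prog_scope.
Local Notation "'unpair' x , y := e 'in' f" := (hcase e hnil (fun x y => f))
  (at level 200, x name, y name, f at level 200) : prog_scope.
Local Notation "'when' 'nil' e 'then' e0 'else' x , y => f" := (hcase e e0 (fun x y => f))
  (at level 200, x name, y name, f at level 200) : prog_scope.
Local Notation "'test' e 'then' e1 'else' e0" := (hcase e e0 (fun _ _ => e1))
  (at level 200, e1 at level 200, e0 at level 200) : prog_scope.
Local Notation "x :o: y" := (Cons x y) (at level 61, right associativity).

(* Positions in the list [prog]. *)
Local Notation Or := 1.
Local Notation Diff := 2.
Local Notation First := 3.
Local Notation IsEmpty := 4.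
Local Notation Le := 5.
Local Notation Cut := 6.
Local Notation Comp := 7.
Local Notation Balanced := 8.
Local Notation Container := 9.
Local Notation Try := 10.
Local Notation Extend := 11.
Local Notation ExtendAll := 12.
Local Notation Append := 13.
Local Notation Search := 14.
Local Notation Decompose := 15.
Local Notation Zeros := 16.
Local Notation Ones := 17.
Local Notation Pad := 18.
Local Notation PathMatrix := 19.

Local Open Scope prog_scope.

Local Notation htrue := (hnil ,, hnil).

(* The bodies are normalized so that evaluation can proceed by matching on
   them. *)
Definition or_body : term := Eval compute in hfun (fun arg =>
  unpair a, b := arg in
  when nil a then hnil else x, a' =>
  unpair y, b' := b in
  (test x then x else y) ,, Or @ (a' ,, b')).

Definition diff_body : term := Eval compute in hfun (fun arg =>
  unpair a, b := arg in
  when nil a then hnil else x, a' =>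
  unpair y, b' := b in
  (test y then hnil else x) ,, Diff @ (a' ,, b')).

Definition first_body : term := Eval compute in hfun (fun a =>
  unpair x, a' := a in
  test x then x ,, Diff @ (a' ,, a') else x ,, First @ a').

Definition isempty_body : term := Eval compute in hfun (fun a =>
  when nil a then htrue else x, a' =>
  test x then hnil else IsEmpty @ a').

Definition le_body : term := Eval compute in hfun (fun arg =>
  unpair a, b := arg in
  test IsEmpty @ a then htrue else
  test IsEmpty @ b then hnil else
  Le @ (Diff @ (a ,, First @ a) ,, Diff @ (b ,, First @ b))).

(** Returns [u] without the neighbours of [s].  Neighbourhoods are needed only
   inside differences. *)
Definition cut_body : term := Eval compute in hfun (fun arg =>
  unpair g, su := arg in
  unpair s, u := su in
  when nil g then u else r, g' =>
  unpair x, s' := s in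
  Cut @ (g' ,, s' ,, (test x then Diff @ (u ,, r) else u))).

(** The list [c] is a unary counter; callers pass the adjacency matrix itself,
   whose length is the number of vertices. *)
Definition comp_body : term := Eval compute in hfun (fun arg =>
  unpair c, arg1 := arg in
  unpair g, arg2 := arg1 in
  unpair v, arg3 := arg2 in
  unpair w, s := arg3 in
  when nil c then s else _0, c' =>
  Comp @ (c' ,, g ,, v ,, w ,, Or @ (v ,, Diff @ (w ,, Cut @ (g ,, s ,, w))))).

Definition balanced_body : term := Eval compute in hfun (fun arg =>
  unpair g, arg1 := arg in
  unpair k, r := arg1 in
  test IsEmpty @ r then htrue else
  bind v := First @ r in
  bind c := Comp @ (g ,, g ,, v ,, r ,, Diff @ (v ,, v)) in
  test Le @ (c ,, Diff @ (k ,, c)) then Balanced @ (g ,, k ,, Diff @ (r ,, c)) else hnil).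

Definition container_body : term := Eval compute in hfun (fun arg =>
  unpair g, arg1 := arg in
  unpair f, arg2 := arg1 in
  unpair js, u := arg2 in
  when nil js then u else j, js' =>
  Container @ (g ,, f ,, js' ,,
    (test IsEmpty @ (Diff @ (j ,, Cut @ (g ,, j ,, u)))
     then Diff @ (u ,, Diff @ (j ,, f)) else u))).

Definition try_body : term := Eval compute in hfun (fun arg =>
  unpair g, arg1 := arg in
  unpair k, arg2 := arg1 in
  unpair js, fs := arg2 in
  unpair f, fs' := fs in
  bind u := Container @ (g ,, f ,, js ,, k) in
  test Balanced @ (g ,, k ,, Diff @ (k ,, u)) then u ,, hnil
  else Try @ (g ,, k ,, js ,, fs')).

Definition extend_body : term := Eval compute in hfun (fun arg =>
  unpair j, arg1 := arg in
  unpair r, acc := arg1 in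
  test IsEmpty @ r then acc else
  bind v := First @ r in
  Or @ (j ,, v) ,, Extend @ (j ,, Diff @ (r ,, v) ,, acc)).

Definition extendall_body : term := Eval compute in hfun (fun arg =>
  unpair k, js := arg in
  unpair j, js' := js in
  Extend @ (j ,, Diff @ (k ,, j) ,, ExtendAll @ (k ,, js'))).

Definition append_body : term := Eval compute in hfun (fun arg =>
  unpair s, t := arg in
  when nil s then t else x, s' =>
  x ,, Append @ (s' ,, t)).

(** At stage [s], the list [js] holds the subsets of [k] of size [s] and [fs]
   the smaller ones, which are the fingerprints to be tried. *)
Definition search_body : term := Eval compute in hfun (fun arg =>
  unpair g, arg1 := arg in
  unpair k, arg2 := arg1 in
  unpair js, fs := arg2 in
  when nil Try @ (g ,, k ,, js ,, fs)
  then Search @ (g ,, k ,, ExtendAll @ (k ,, js) ,, Append @ (js ,, fs))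
  else u, _0 => u).

(** Puts the bags for the vertex set [w], with [b] added to each, in front of
   [acc]. *)
Definition decompose_body : term := Eval compute in hfun (fun arg =>
  unpair g, arg1 := arg in
  unpair w, arg2 := arg1 in
  unpair b, acc := arg2 in
  test IsEmpty @ w then acc else
  bind v := First @ w in
  bind z := Diff @ (v ,, v) in
  bind c := Comp @ (g ,, g ,, v ,, w ,, z) in
  bind u := Search @ (g ,, c ,, (z ,, hnil) ,, hnil) in
  bind b' := Or @ (u ,, b) in
  b' ,, Decompose @ (g ,, Diff @ (c ,, u) ,, b' ,,
          Decompose @ (g ,, Diff @ (w ,, c) ,, b ,, acc))).

Definition zeros_body : term := Eval compute in hfun (fun s =>
  unpair x, s' := s in hnil ,, Zeros @ s').

Definition ones_body : term := Eval compute in hfun (fun s =>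
  unpair x, s' := s in htrue ,, Ones @ s').

Definition pad_body : term := Eval compute in hfun (fun m =>
  unpair r, m' := m in (hnil ,, r) ,, Pad @ m').

Definition pathmatrix_body : term := Eval compute in hfun (fun s =>
  unpair x, s' := s in
  bind m := PathMatrix @ s' in
  when nil m then ((hnil ,, hnil) ,, hnil) else r, m' =>
  (hnil ,, htrue ,, Zeros @ m') ,, (htrue ,, r) ,, Pad @ m').

Definition main_body : term := Eval compute in hfun (fun g =>
  bind s := Decompose @ (g ,, Ones @ g ,, Zeros @ g ,, hnil) in
  PathMatrix @ s ,, s).

Local Close Scope prog_scope.

Definition prog : program :=
  [:: main_body; or_body; diff_body; first_body; isempty_body; le_body;
      cut_body; comp_body; balanced_body; container_body; try_body;
      extend_body; extendall_body; append_body; search_body; decompose_body;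
      zeros_body; ones_body; pad_body; pathmatrix_body].

(** * Evaluation within a time bound *)

Definition ev (s : seq data) (e : term) (v : data) (T : nat) : Prop :=
  exists2 t, eval prog s e v t & t <= T.

Definition fn (f : nat) (x y : data) (T : nat) : Prop :=
  ev [:: x] (nth TNil prog f) y T.

Lemma ev_var s i v : nth Nil s i = v -> ev s (TVar i) v 1.
Proof. by move=> <-; exists 1 => //; constructor. Qed.

Lemma ev_nil s : ev s TNil Nil 1.
Proof. by exists 1 => //; constructor. Qed.

Lemma ev_cons s e1 e2 v1 v2 T1 T2 :
  ev s e1 v1 T1 -> ev s e2 v2 T2 -> ev s (TCons e1 e2) (Cons v1 v2) (T1 + T2).+1.
Proof.
by move=> [t1 ev1 le1] [t2 ev2 le2]; exists (t1 + t2).+1; [constructor | rewrite ltnS leq_add].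
Qed.

Lemma ev_let s e1 e2 v1 v2 T1 T2 :
  ev s e1 v1 T1 -> ev (v1 :: s) e2 v2 T2 -> ev s (TLet e1 e2) v2 (T1 + T2).+1.
Proof.
move=> [t1 ev1 le1] [t2 ev2 le2]; exists (t1 + t2).+1; last by rewrite ltnS leq_add.
by econstructor; eassumption.
Qed.

Lemma ev_case s e e0 e1 v w T1 T2 : ev s e v T1 ->
  match v with
  | Nil => ev s e0 w T2
  | Cons a b => ev [:: a, b & s] e1 w T2
  end -> ev s (TCase e e0 e1) w (T1 + T2).+1.
Proof.
case: v => [|a b] [t1 ev1 le1] [t2 ev2 le2]; exists (t1 + t2).+1;
  by [rewrite ltnS leq_add | econstructor; eassumption].
Qed.

Lemma ev_call s f e v w T1 T2 :
  ev s e v T1 -> fn f v w T2 -> ev s (TCall f e) w (T1 + T2).+1.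
Proof.
move=> [t1 ev1 le1] [t2 ev2 le2]; exists (t1 + t2).+1; last by rewrite ltnS leq_add.
by econstructor; eassumption.
Qed.

Lemma ev_weaken s e v v' T T' : ev s e v T -> v = v' -> T <= T' -> ev s e v' T'.
Proof. by move=> [t evt tT] <- TT'; exists t => //; apply: leq_trans TT'. Qed.

Lemma fn_weaken f x y T T' : fn f x y T -> T <= T' -> fn f x y T'.
Proof. by move=> H; apply: ev_weaken H _. Qed.

(** The bit vector of [A] along an arbitrary list [e], for inductions on [e];
   [code_set] is the case of the full enumeration. *)
Definition vec (T : finType) (e : seq T) (A : {set T}) : data :=
  code_seq (fun x => code_bool (x \in A)) e.

(* Evaluates the current term; the calls it makes are looked up in the
   context. *)
Ltac run :=
  lazymatch goal with
  | |- ev _ (TVar _) _ _ => eapply ev_var; cbn [nth]; reflexivity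
  | |- ev _ TNil _ _ => eapply ev_nil
  | |- ev _ (TCons _ _) _ _ => eapply ev_cons; [run | run]
  | |- ev _ (TLet _ _) _ _ => eapply ev_let; [run | run]
  | |- ev _ (TCase _ _ _) _ _ =>
      eapply ev_case; [run | cbn [code_bool vec code_seq foldr]; run]
  | |- ev _ (TCall _ _) _ _ => eapply ev_call; [run | eassumption]
  end.

(* Leaves the correctness of the value and the time bound as subgoals. *)
Ltac exec body := rewrite /fn; cbn [nth prog]; rewrite /body;
  eapply ev_weaken; [run | | ].

Ltac execute body := exec body; [by [] | rewrite /=; first [lia | nia]].

(** * Correctness of the operations on vertex sets *)

Section VectorPrograms.
Variable T : finType.
Implicit Types (e : seq T) (A B : {set T}).

Lemma vec_eq e A B : {in e, A =i B} -> vec e A = vec e B.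
Proof.
elim: e => //= x e IH AB; rewrite /vec /= AB ?mem_head // -!/(vec _ _) IH // => y ye.
by apply: AB; rewrite inE ye orbT.
Qed.

Lemma or_spec e A B :
  fn Or (vec e A :o: vec e B) (vec e (A :|: B)) (20 * (size e).+1).
Proof.
elim: e => [|x e IH]; first by exec or_body.
rewrite /vec /= in_setU -!/(vec _ _).
by case: (x \in A); case: (x \in B); execute or_body.
Qed.

Lemma diff_spec e A B :
  fn Diff (vec e A :o: vec e B) (vec e (A :\: B)) (20 * (size e).+1).
Proof.
elim: e => [|x e IH]; first by exec diff_body.
rewrite /vec /= in_setD -!/(vec _ _).
by case: (x \in A); case: (x \in B); execute diff_body.
Qed.

Lemma isempty_spec e A :
  fn IsEmpty (vec e A) (code_bool (~~ has (mem A) e)) (10 * (size e).+1).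
Proof.
elim: e => [|x e IH]; first by exec isempty_body.
by rewrite /vec /= -!/(vec _ _); case: (x \in A); execute isempty_body.
Qed.

Lemma first_spec e A : uniq e -> has (mem A) e ->
  exists2 v, v \in A & fn First (vec e A) (vec e [set v]) (30 * (size e).+1).
Proof.
elim: e => [|x e IH] //= /andP[xe ue].
case xA: (x \in A).
  move=> _; exists x => //; have := diff_spec e A A.
  rewrite (vec_eq (A := A :\: A) (B := [set x])) => [H|y ye]; last first.
    by rewrite !inE andNb; apply/esym/negbTE; apply: contraNneq xe => <-.
  by rewrite /vec /= set11 -!/(vec _ _); execute first_body.
move=> hA; have [v vA IHv] := IH ue hA.
exists v => //; rewrite in_set1 (negbTE (_ : x != v)) -!/(vec _ _).
  by execute first_body.
by apply: contraFneq xA => ->.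
Qed.

End VectorPrograms.

Section GraphPrograms.
Variable G : sgraph.
Implicit Types (v : G) (K W U X Z A B C F J R S : {set G}) (Js Fs : seq {set G}).

Local Notation N := (#|G|.+1).
Local Notation cs := (@code_set G).
Local Notation css := (code_seq (@code_set G)).
Local Notation cg := (code_graph G).

Lemma or_set A B : fn Or (cs A :o: cs B) (cs (A :|: B)) (20 * N).
Proof. by have := or_spec (enum G) A B; rewrite -cardE. Qed.

Lemma diff_set A B : fn Diff (cs A :o: cs B) (cs (A :\: B)) (20 * N).
Proof. by have := diff_spec (enum G) A B; rewrite -cardE. Qed.

Lemma isempty_set A : fn IsEmpty (cs A) (code_bool (A == set0)) (10 * N).
Proof.
have := isempty_spec (enum G) A; rewrite -cardE.
suff -> : ~~ has (mem A) (enum G) = (A == set0) by [].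
apply/hasPn/eqP => [H|-> x _]; last by rewrite /= inE.
by apply/setP => x; rewrite inE; apply/negbTE/H; rewrite mem_enum.
Qed.

Lemma first_set A : A != set0 ->
  exists2 v, v \in A & fn First (cs A) (cs [set v]) (30 * N).
Proof.
move=> /set0Pn[x xA]; rewrite cardE; apply: first_spec (enum_uniq _) _.
by apply/hasP; exists x; rewrite ?mem_enum.
Qed.

Lemma le_set A B :
  fn Le (cs A :o: cs B) (code_bool (#|A| <= #|B|)) (200 * N * #|A|.+1).
Proof.
have [n] := ubnP #|A|; elim: n A B => // n IH A B; rewrite ltnS => An.
have [->|A0] := eqVneq A set0.
  by have := isempty_set set0; rewrite eqxx cards0 => eA; execute le_body.
have := isempty_set A; rewrite (negbTE A0) => eA.
have [->|B0] := eqVneq B set0.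
  have := isempty_set set0; rewrite eqxx cards0 leqn0 cards_eq0 (negbTE A0) => eB.
  by execute le_body.
have := isempty_set B; rewrite (negbTE B0) => eB.
have [a aA fA] := first_set A0; have [b bB fB] := first_set B0.
have dA := diff_set A [set a]; have dB := diff_set B [set b].
have cA := cardsD1 a A; have cB := cardsD1 b B.
rewrite aA in cA; rewrite bB in cB.
have rec : fn Le (cs (A :\ a) :o: cs (B :\ b)) (code_bool (#|A| <= #|B|)) (200 * N * #|A|).
  by rewrite cA cB leq_add2l; apply: IH; rewrite cA in An.
exec le_body => //.
rewrite cA; nia.
Qed.

Lemma cut_spec (e : seq G) J U :
  fn Cut (code_seq (fun x => cs [set y | edge x y]) e :o: vec e J :o: cs U)
    (cs (U :\: [set y | has (fun x => (x \in J) && edge x y) e]))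
    (100 * N * (size e).+1).
Proof.
elim: e U => [|x e IH] U.
  rewrite (_ : [set y | _] = set0) ?setD0; last by apply/setP => y; rewrite !inE.
  by execute cut_body.
rewrite /vec /= -/(vec _ _).
case xJ: (x \in J).
  have d := diff_set U [set y | edge x y].
  have := IH (U :\: [set y | edge x y]); rewrite setDDl => rec.
  exec cut_body; last (rewrite !mulnS; lia).
  by congr (cs (_ :\: _)); apply/setP => y; rewrite !inE.
have rec := IH U.
exec cut_body; last (rewrite !mulnS; lia).
by congr (cs (_ :\: _)); apply/setP => y; rewrite !inE.
Qed.

Lemma cut_set J U :
  fn Cut (cg :o: cs J :o: cs U) (cs (U :\: nbrs J)) (100 * (N * N)).
Proof.
have := cut_spec (enum G) J U; rewrite -cardE mulnA.
suff -> : [set y | has (fun x => (x \in J) && edge x y) (enum G)] = nbrs J by [].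
apply/setP => y; rewrite inE; apply/hasP/nbrsP => [[x _ /andP[]]|[x xJ xy]].
  by exists x.
by exists x; rewrite ?mem_enum ?xJ.
Qed.

Lemma comp_iter T (f : T -> data) l v W S :
  fn Comp (code_seq f l :o: cg :o: cs [set v] :o: cs W :o: cs S)
    (cs (iter (size l) (comp_step v W) S)) (200 * (N * N) * (size l).+1).
Proof.
elim: l S => [|x l IH] S; first by execute comp_body.
have c := cut_set S W; have d := diff_set W (W :\: nbrs S).
have o := or_set [set v] (W :\: (W :\: nbrs S)).
have := IH ([set v] :|: (W :\: (W :\: nbrs S))); rewrite -/(size _).
have -> : [set v] :|: (W :\: (W :\: nbrs S)) = comp_step v W S.
  by rewrite setDDr setDv set0U setIC.
rewrite setDDr setDv set0U setIC in d o.
rewrite -iterSr => rec.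
execute comp_body.
Qed.

Lemma comp_set v W :
  fn Comp (cg :o: cg :o: cs [set v] :o: cs W :o: cs set0)
    (cs (comp v W)) (200 * (N * N * N)).
Proof.
have := comp_iter (fun x => cs [set y | edge x y]) (enum G) v W set0.
by rewrite -cardE -mulnA.
Qed.

End GraphPrograms.

(** * Correctness of the search for a separator *)

Section SearchPrograms.
Variable G : sgraph.
Implicit Types (v : G) (K W U X Z A B C F J R S : {set G}) (Js Fs : seq {set G}).

Local Notation N := (#|G|.+1).
Local Notation cs := (@code_set G).
Local Notation css := (code_seq (@code_set G)).
Local Notation cg := (code_graph G).

Lemma N_exp s : 0 < N ^ s.
Proof. by rewrite expn_gt0. Qed.

Lemma cardN A : #|A| < N.
Proof. by rewrite ltnS max_card. Qed.

Lemma N_monomials : [/\ 0 < N, N <= N * N, N * N <= N * N * N & N * N * N <= N * N * N * N].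
Proof. by split; rewrite // ?leq_pmull // leq_pmulr. Qed.

(** The components other than the first one are tested inside [R] minus the
   first one, which does not change them ([comp_setD]); the vertices of the
   first one need no test, since their components are contained in it. *)
Lemma balanced_rest K R :
  fn Balanced (cg :o: cs K :o: cs R)
    (code_bool [forall v in R, #|comp v R| <= #|K :\: comp v R|])
    (1000 * (N * N * N) * #|R|.+1).
Proof.
have [n] := ubnP #|R|; elim: n R => // n IH R; rewrite ltnS => Rn.
have [->|R0] := eqVneq R set0.
  have := isempty_set (set0 : {set G}); rewrite eqxx cards0 => eR.
  have -> : [forall v in set0, #|comp v set0| <= #|K :\: comp v set0|] = true.
    by apply/forall_inP => v; rewrite inE.
  execute balanced_body.
have := isempty_set R; rewrite (negbTE R0) => eR.
have [v vR fR] := first_set R0.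
have z := diff_set [set v] [set v]; rewrite setDv in z.
have c := comp_set v R.
have d := diff_set K (comp v R).
have le : fn Le (cs (comp v R) :o: cs (K :\: comp v R))
    (code_bool (#|comp v R| <= #|K :\: comp v R|)) (200 * (N * N)).
  by apply: fn_weaken (le_set _ _) _; rewrite -mulnA leq_mul2l leq_mul2l cardN orbT.
have [N1 N2 N3 _] := N_monomials.
case cmp: (#|comp v R| <= #|K :\: comp v R|) in le *; last first.
  have -> : [forall v in R, #|comp v R| <= #|K :\: comp v R|] = false.
    by apply/negbTE/forall_inPn; exists v; rewrite ?cmp.
  by exec balanced_body => //; apply: leq_trans (leq_pmulr _ _) => //; lia.
have d' := diff_set R (comp v R).
have CR := comp_sub vR.
have cR : #|comp v R| + #|R :\: comp v R| = #|R|.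
  by rewrite -(cardsID (comp v R) R) (setIidPr CR).
have C0 : 0 < #|comp v R| by apply/card_gt0P; exists v; apply: mem_comp.
have rec := IH (R :\: comp v R) (ltac:(lia)).
have eq : [forall u in R, #|comp u R| <= #|K :\: comp u R|] =
    [forall u in R :\: comp v R, #|comp u (R :\: comp v R)| <= #|K :\: comp u (R :\: comp v R)|].
  apply/forall_inP/forall_inP => H u uR.
    by rewrite comp_setD //; apply: H; move: uR; rewrite inE => /andP[].
  case: (boolP (u \in comp v R)) => uC; last first.
    by have := H u; rewrite comp_setD ?inE ?uC //; apply.
  apply: leq_trans (leq_trans cmp _); apply: subset_leq_card; first exact: comp_trans.
  by apply/setDS/comp_trans.
rewrite eq; exec balanced_body => //.
have : 1000 * (N * N * N) * #|R :\: comp v R|.+1 <= 1000 * (N * N * N) * #|R|.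
  by rewrite leq_mul2l -cR -[X in X < _]add0n ltn_add2r C0 orbT.
by rewrite [_ * #|R|.+1]mulnS; lia.
Qed.

Lemma balanced_set K U :
  fn Balanced (cg :o: cs K :o: cs (K :\: U)) (code_bool (balanced K U))
    (1000 * (N * N * N * N)).
Proof.
apply: fn_weaken (balanced_rest _ _) _.
by rewrite -[leqLHS]mulnA leq_mul2l leq_mul2l cardN !orbT.
Qed.

Lemma container_set F Js U :
  fn Container (cg :o: cs F :o: css Js :o: cs U) (cs (container F Js U))
    (250 * (N * N) * (size Js).+1).
Proof.
elim: Js U => [|J Js IH] U /=; first execute container_body.
have c := cut_set J U.
have d := diff_set J (U :\: nbrs J).
have := isempty_set (J :\: (U :\: nbrs J)); rewrite setD_eq0.
case: ifP => _ e.
  have d1 := diff_set J F; have d2 := diff_set U (J :\: F).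
  have rec := IH (U :\: (J :\: F)); execute container_body.
have rec := IH U; execute container_body.
Qed.

Lemma try_set K Js Fs :
  exists2 y, fn Try (cg :o: cs K :o: css Js :o: css Fs) y
      (1500 * (N * N * N * N) * (size Js).+1 * (size Fs).+1) &
    if y is Nil then forall F, F \in Fs -> ~~ balanced K (container F Js K)
    else exists F, [/\ F \in Fs, balanced K (container F Js K) &
      y = Cons (cs (container F Js K)) Nil].
Proof.
elim: Fs => [|F Fs [y IH yP]]; first by exists Nil => //; execute try_body.
have c := container_set F Js K.
have d := diff_set K (container F Js K).
have b := balanced_set K (container F Js K).
case bal: (balanced K (container F Js K)) in b *.
  exists (Cons (cs (container F Js K)) Nil); first by execute try_body.
  by exists F; rewrite mem_head.
exists y; first by execute try_body.
case: y {IH} yP => [H F'|y1 y2 [F' [FF' bF' ->]]].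
  by rewrite inE => /predU1P[->|]; [rewrite bal | apply: H].
by exists F'; rewrite inE FF' orbT.
Qed.

Lemma extend_set J R Js :
  exists L, [/\ fn Extend (cs J :o: cs R :o: css Js) (css (L ++ Js)) (200 * N * #|R|.+1),
    size L = #|R| & forall X, (X \in L) = [exists v in R, X == v |: J]].
Proof.
have [n] := ubnP #|R|; elim: n R => // n IH R; rewrite ltnS => Rn.
have [->|R0] := eqVneq R set0.
  have := isempty_set (set0 : {set G}); rewrite eqxx cards0 => eR.
  exists [::]; split=> [||X]; rewrite ?cards0 //; first execute extend_body.
  by apply/esym/exists_inP => -[v]; rewrite inE.
have := isempty_set R; rewrite (negbTE R0) => eR.
have [v vR fR] := first_set R0.
have d := diff_set R [set v].
have o := or_set J [set v].
have cR := cardsD1 v R; rewrite vR in cR.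
have [L [rec sL LP]] := IH (R :\ v) (ltac:(lia)).
exists ((J :|: [set v]) :: L); split; first by rewrite cR; execute extend_body.
  by rewrite /= sL cR.
move=> X; rewrite inE LP setUC; apply/predU1P/exists_inP => [[->|/exists_inP[u]]|[u uR /eqP ->]].
- by exists v.
- by rewrite inE => /andP[_ uR] Xu; exists u.
- have [->|uv] := eqVneq u v; first by left.
  by right; apply/exists_inP; exists u; rewrite // !inE uv.
Qed.

Lemma extendall_set K Js :
  exists L, [/\ fn ExtendAll (cs K :o: css Js) (css L) (300 * (N * N) * (size Js).+1),
    size L <= N * size Js &
    forall X, X \in L <-> exists2 J, J \in Js & exists2 v, v \in K :\: J & X = v |: J].
Proof.
elim: Js => [|J Js [L [IH sL LP]]].
  exists [::]; split=> // [|X]; first execute extendall_body.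
  by split=> // -[J].
have d := diff_set K J.
have [L' [ext0 sL' LP']] := extend_set J (K :\: J) L.
have {ext0} ext : fn Extend (cs J :o: cs (K :\: J) :o: css L) (css (L' ++ L)) (200 * (N * N)).
  by apply: fn_weaken ext0 _; rewrite -mulnA !leq_mul2l cardN !orbT.
have [N1 N2 _ _] := N_monomials.
exists (L' ++ L); split; first by exec extendall_body => //; rewrite /= [_ * (size _).+2]mulnS; lia.
  by rewrite size_cat sL' /= mulnS leq_add // ltnW // cardN.
move=> X; rewrite mem_cat LP'; split=> [/orP[/exists_inP[v vKJ /eqP XJ]|/LP[J' J'Js H]]|[J']].
- by exists J; rewrite ?mem_head //; exists v.
- by exists J'; rewrite // inE J'Js orbT.
- rewrite inE => /predU1P[-> [v vKJ ->]|J'Js [v vKJ' ->]].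
    by apply/orP; left; apply/exists_inP; exists v.
  by apply/orP; right; apply/LP; exists J' => //; exists v.
Qed.

Lemma append_set Js Fs :
  fn Append (css Js :o: css Fs) (css (Js ++ Fs)) (10 * (size Js).+1).
Proof.
elim: Js => [|J Js IH]; first execute append_body.
by execute append_body.
Qed.

(** The search succeeds at stage [S] at the latest.  The quantifier over [Js]
   is there because containers depend on the order of the enumeration, and the
   order that the program produces is of no interest. *)
Definition separable K (S : nat) : Prop :=
  forall Js, (forall J, J \in Js -> #|J| = S) ->
  exists F, [/\ F \subset K, #|F| < S & balanced K (container F Js K)].

Section Stages.
Variables (K : {set G}) (S : nat).
Hypothesis G0 : 0 < #|G|.
Hypothesis sepK : separable K S.
Local Notation P := (N ^ S).

(** Repetitions are allowed: the program extends sets in all possible ways, so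
   a set of size [s] turns up [s`!] times. *)
Definition stage_lists s Js Fs : Prop :=
  [/\ forall J, (J \in Js) = (J \subset K) && (#|J| == s),
      forall F, (F \in Fs) = (F \subset K) && (#|F| < s),
      size Js <= N ^ s & size Fs <= N ^ s].

Lemma next_stage s Js Fs L : stage_lists s Js Fs -> size L <= N * size Js ->
  (forall X, X \in L <-> exists2 J, J \in Js & exists2 v, v \in K :\: J & X = v |: J) ->
  stage_lists s.+1 L (Js ++ Fs).
Proof.
move=> [JsP FsP sJs sFs] sL LP; split.
- move=> X; apply/idP/andP => [/LP[J]|[XK /eqP cX]].
    rewrite JsP => /andP[JK /eqP cJ] [v]; rewrite inE => /andP[vJ vK] ->.
    by rewrite subUset sub1set vK JK cardsU1 vJ cJ.
  have /card_gt0P[v vX] : 0 < #|X| by rewrite cX.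
  have := cardsD1 v X; rewrite vX cX add1n => -[cXv].
  apply/LP; exists (X :\ v).
    by rewrite JsP (subset_trans (subsetDl _ _) XK) -cXv eqxx.
  by exists v; rewrite ?setD1K // !inE eqxx (subsetP XK).
- move=> F; rewrite mem_cat JsP FsP ltnS -andb_orr; congr (_ && _).
  by rewrite [RHS]leq_eqVlt.
- by apply: leq_trans sL _; rewrite expnS leq_mul2l sJs orbT.
- rewrite size_cat; apply: leq_trans (leq_add sJs sFs) _.
  by rewrite addnn -mul2n expnS leq_mul2r ltnS G0 orbT.
Qed.

Lemma try_stage s Js Fs : s <= S -> stage_lists s Js Fs ->
  exists2 y, fn Try (cg :o: cs K :o: css Js :o: css Fs) y
      (4 * 1500 * (N * N * N * N * (P * P))) &
    if y is Nil then s < S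
    else exists U, [/\ y = Cons (cs U) Nil, U \subset K, balanced K U & alpha_set U < S].
Proof.
move=> sS [JsP FsP sJs sFs]; have [y ty yP] := try_set K Js Fs; exists y.
  apply: fn_weaken ty _.
  have two l : l <= N ^ s -> l.+1 <= 2 * P.
    move=> ls; have : N ^ s <= P by rewrite leq_pexp2l.
    by have := N_exp S; lia.
  apply: leq_trans (_ : 1500 * (N * N * N * N) * (2 * P) * (2 * P) <= _).
    by rewrite leq_mul ?leq_mul ?two.
  move: (N * N * N * N) P => a b. nia.
case: y {ty} yP => [none|y1 y2 [F [FFs bF ->]]].
  rewrite ltn_neqAle sS andbT; apply/eqP => s_S.
  have [|F [FK cF bF]] := sepK (Js := Js).
    by move=> J; rewrite JsP s_S => /andP[_ /eqP].
  by have := none F; rewrite FsP FK s_S cF bF => /(_ isT).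
exists (container F Js K); split=> //; first exact: container_sub.
move: FFs; rewrite FsP => /andP[_ cF]; apply: leq_trans sS.
by apply: alpha_container cF _ => J JK cJ; rewrite JsP JK cJ eqxx.
Qed.

Lemma search_stage m s Js Fs : s + m = S -> stage_lists s Js Fs ->
  exists U, [/\ fn Search (cg :o: cs K :o: css Js :o: css Fs) (cs U)
      (6 * 1500 * (N * N * N * N * (P * P)) * m.+1),
    U \subset K, balanced K U & alpha_set U < S].
Proof.
elim: m s Js Fs => [|m IH] s Js Fs smS stg;
  have [|y ty yP] := try_stage _ stg; try by rewrite -smS leq_addr.
all: have P0 : 0 < N * N * N * N * (P * P) by rewrite !muln_gt0 N_exp.
all: case: y ty yP => [|y1 y2] ty yP; last have [U [[? ?] UK bU aU]] := yP.
- by rewrite -smS addn0 ltnn in yP.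
- by subst; exists U; split=> //; exec search_body => //; lia.
- have [L [ex sL LP]] := extendall_set K Js.
  have ap := append_set Js Fs.
  have [U [rec UK bU aU]] := IH _ _ _ (etrans (addSnnS _ _) smS) (next_stage stg sL LP).
  exists U; split=> //; exec search_body => //.
  have [_ _ sJs _] := stg.
  have sP : N ^ s <= P by rewrite leq_pexp2l // -smS leq_addr.
  have P1 := N_exp S; have [N1 N2 N3 N4] := N_monomials.
  have cost1 : 300 * (N * N) * (size Js).+1 <= 600 * (N * N * N * N * (P * P)).
    have -> : 600 * (N * N * N * N * (P * P)) = 300 * (N * N * N * N) * (2 * (P * P)).
      by move: (N * N * N * N) P => a b; nia.
    by rewrite leq_mul // ?leq_mul2l ?(leq_trans N3) // ; nia.
  have cost2 : 10 * (size Js).+1 <= 20 * (N * N * N * N * (P * P)).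
    have : 10 * (size Js).+1 <= 20 * (P * P) by nia.
    by move=> /leq_trans; apply; rewrite leq_mul2l /= leq_pmull ?muln_gt0.
  move: rec cost1 cost2 P0 => _; move: (N * N * N * N * (P * P)) => Q cost1 cost2 P0.
  rewrite [_ * m.+2]mulnS; lia.
- by subst; exists U; split=> //; exec search_body => //; nia.
Qed.

Lemma search_set : exists U,
  [/\ fn Search (cg :o: cs K :o: css [:: set0] :o: css [::]) (cs U)
      (6 * 1500 * (N * N * N * N * (P * P)) * S.+1),
    U \subset K, balanced K U & alpha_set U < S].
Proof.
apply: (@search_stage S 0) => //; split=> // [J|F]; last by rewrite ltn0 andbF.
by rewrite inE cards_eq0; apply/eqP/andP => [->|[_ /eqP]] //; rewrite sub0set.
Qed.

End Stages.

End SearchPrograms.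

(** * The path decomposition built from separators *)

Section Layouts.
Variable G : sgraph.
Implicit Types (u v w : G) (K W U X B C : {set G}) (bs : seq {set G}).

(** Stated through the pattern of memberships, because concatenating lists of
   bags concatenates these patterns. *)
Definition interval_of v bs : Prop :=
  exists a b c, [seq v \in X | X <- bs] = nseq a false ++ nseq b.+1 true ++ nseq c false.

(** [bs] is a path decomposition of [G[W]] to all of whose bags the set [B]
   was added. *)
Record layout W B bs : Prop := Layout {
  layout_sub : forall X, X \in bs -> B \subset X /\ X \subset B :|: W;
  layout_interval : forall v, v \in W -> interval_of v bs;
  layout_edge : forall u v, u \in W -> v \in W -> edge u v ->
    exists2 X, X \in bs & (u \in X) && (v \in X);
  layout_size : size bs <= #|W|
}.

Lemma layout_nil B : layout set0 B [::].
Proof. by split=> // [v|u v]; rewrite inE. Qed.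

Lemma map_const (f : {set G} -> bool) b bs :
  (forall X, X \in bs -> f X = b) -> map f bs = nseq (size bs) b.
Proof.
elim: bs => //= X bs IH H; rewrite H ?mem_head // IH // => Y Ybs.
by apply: H; rewrite inE Ybs orbT.
Qed.

(** As [C] is a union of components, its vertices occur only in the first bag
   and in [bs1], and those of [U] in all of these. *)
Lemma layout_cons W B C U bs1 bs2 : [disjoint B & W] -> C \subset W -> U \subset C -> U != set0 ->
  (forall x y, x \in C -> edge x y -> y \in W -> y \in C) ->
  layout (C :\: U) (U :|: B) bs1 -> layout (W :\: C) B bs2 ->
  layout W B (U :|: B :: bs1 ++ bs2).
Proof.
move=> BW CW UC U0 clC [sub1 int1 edge1 size1] [sub2 int2 edge2 size2].
have UW := subset_trans UC CW.
have notB v : v \in W -> v \in B = false by move=> vW; apply: (disjointFl BW).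
have out1 v X : v \in W -> v \notin C -> X \in bs1 -> v \in X = false.
  move=> vW vC /sub1[_ /subsetP XS]; apply/negbTE; apply: contra vC => /XS.
  rewrite !inE notB // orbF => /orP[/(subsetP UC)//|/andP[]//].
have out2 v X : v \in C -> X \in bs2 -> v \in X = false.
  move=> vC /sub2[_ /subsetP XS]; apply: contraTF vC => /XS.
  by rewrite !inE => /orP[vB|/andP[]//]; apply: contraTN vB => /(subsetP CW)/notB ->.
have in1 v X : v \in U -> X \in bs1 -> v \in X.
  by move=> vU /sub1[/subsetP H _]; apply: H; rewrite inE vU.
split.
- move=> X; rewrite inE mem_cat => /predU1P[->|/orP[/sub1[]|/sub2[]]].
  + by rewrite subsetUr subUset subsetUl (subset_trans UW) ?subsetUr.
  + move=> UX XS; split; first exact: subset_trans (subsetUr _ _) UX.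
    apply: subset_trans XS _; rewrite !subUset subsetUl (subset_trans UW) ?subsetUr //=.
    by rewrite (subset_trans (subsetDl _ _)) // (subset_trans CW) ?subsetUr.
  + move=> BX XS; split=> //; apply: subset_trans XS _.
    by rewrite setUS // subsetDl.
- move=> v vW; rewrite /interval_of /= map_cat.
  case: (boolP (v \in C)) => vC; last first.
    have [|a [b [c E]]] := int2 v; first by rewrite inE vC.
    exists ((size bs1).+1 + a), b, c.
    rewrite E (map_const (b := false) (bs := bs1)) => [|X]; last exact: out1.
    have vU : v \in U = false by apply: contraNF vC; apply: (subsetP UC).
    by rewrite in_setU vU notB // nseqD -catA.
  rewrite (map_const (b := false) (bs := bs2)); last by move=> X; apply: out2.
  case: (boolP (v \in U)) => vU.
    exists 0, (size bs1), (size bs2).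
    rewrite (map_const (b := true) (bs := bs1)) => [|X]; last exact: in1.
    by rewrite in_setU vU.
  have [|a [b [c E]]] := int1 v; first by rewrite inE vU.
  exists a.+1, b, (c + size bs2).
  by rewrite E in_setU (negbTE vU) notB //= nseqD -!catA /= -!catA.
- move=> u v uW vW uv.
  have memV X : X \in U :|: B :: bs1 ++ bs2 = [|| X == U :|: B, X \in bs1 | X \in bs2].
    by rewrite inE mem_cat.
  have occ1 w : w \in C :\: U -> exists2 X, X \in bs1 & w \in X.
    move=> /int1[a [b [c E]]]; have : true \in [seq w \in X | X <- bs1].
      by rewrite E !mem_cat mem_head orbT.
    by move=> /mapP[X Xbs1 wX]; exists X.
  case uC: (u \in C); last first.
    have vC : v \notin C by apply/negP => vC; move: uC; rewrite (clC v u) // edge_sym.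
    have [||X X2 Xuv] := edge2 u v _ _ uv; rewrite ?inE ?uC ?vC //.
    by exists X; rewrite // memV X2 !orbT.
  have vC := clC _ _ uC uv vW.
  case uU: (u \in U); case vU: (v \in U).
  + by exists (U :|: B); rewrite ?memV ?eqxx // !inE uU vU.
  + have [|X X1 vX] := occ1 v; first by rewrite inE vU.
    by exists X; rewrite ?memV ?X1 ?orbT // vX in1.
  + have [|X X1 uX] := occ1 u; first by rewrite inE uU.
    by exists X; rewrite ?memV ?X1 ?orbT // uX in1.
  + have [||X X1 Xuv] := edge1 u v _ _ uv; rewrite ?inE ?uU ?vU //.
    by exists X; rewrite // memV X1 !orbT.
- rewrite /= size_cat.
  have := cardsID C W; rewrite (setIidPr CW).
  have := cardsID U C; rewrite (setIidPr UC).
  by move: U0; rewrite -card_gt0; lia.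
Qed.

End Layouts.

(** * Correctness of the recursive decomposition *)

Section DecomposeProgram.
Variables (G : sgraph) (sz g : nat -> nat) (S : nat).
Hypothesis G0 : 0 < #|G|.
Hypothesis sepG : forall K : {set G}, K != set0 -> separable K (sz #|K|).
Hypothesis sz_max : forall k, k <= #|G| -> sz k <= S.
Hypothesis g_mono : {homo g : k m / k <= m}.
Hypothesis g_half : forall k m, 0 < k -> m.*2 <= k -> sz k + g m <= g k.
Implicit Types (u v w : G) (K W U X B C : {set G}) (bs acc : seq {set G}).

Local Notation N := (#|G|.+1).
Local Notation cs := (@code_set G).
Local Notation css := (code_seq (@code_set G)).
Local Notation cg := (code_graph G).
Local Notation P := (N ^ S).
Local Notation Q := (7 * 1500 * (N * N * N * N * (P * P) * S.+1)).

Lemma separator_set K : K != set0 -> exists U,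
  [/\ fn Search (cg :o: cs K :o: css [:: set0] :o: css [::]) (cs U)
      (6 * 1500 * (N * N * N * N * (P * P) * S.+1)),
    U \subset K, balanced K U & alpha_set U <= sz #|K|].
Proof.
move=> K0; have [U [tU UK bU aU]] := search_set G0 (sepG K0).
exists U; split=> //; last exact: ltnW.
have szS : sz #|K| <= S := sz_max (max_card _).
have PP : N ^ sz #|K| <= P by rewrite leq_pexp2l.
by apply: fn_weaken tU _; rewrite -[leqLHS]mulnA leq_mul // leq_mul // leq_mul // leq_mul.
Qed.

Lemma cost_atoms : [/\ 0 < N, N <= N * N * N & N * N * N <= N * N * N * N * (P * P) * S.+1].
Proof.
have [N1 N2 N3 N4] := N_monomials G; split=> //; first exact: leq_trans N3.
by apply: leq_trans N4 _; rewrite -[leqRHS]mulnA leq_pmulr // !muln_gt0 N_exp.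
Qed.

(** The bound on independence numbers is stated for every bound [m] on the sizes
   of components, since this is what passes to [W :\: C] unchanged and to
   [C :\: U] with half the value. *)
Lemma decompose_set W B acc : [disjoint B & W] -> exists bs,
  [/\ fn Decompose (cg :o: cs W :o: cs B :o: css acc) (css (bs ++ acc)) (Q * (2 * #|W|).+1),
    layout W B bs &
    forall m, (forall v, v \in W -> #|comp v W| <= m) ->
      forall X, X \in bs -> alpha_set X <= alpha_set B + g m].
Proof.
have [n] := ubnP #|W|; elim: n W B acc => // n IH W B acc; rewrite ltnS => Wn BW.
have [->|W0] := eqVneq W set0.
  have := isempty_set (set0 : {set G}); rewrite eqxx cards0 => eW.
  exists [::]; split=> //; last exact: layout_nil.
  exec decompose_body => //; rewrite muln0 muln1; have [] := cost_atoms.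
  by move: N (N * N * N) (_ * S.+1) => a b c; clear; lia.
have := isempty_set W; rewrite (negbTE W0) => eW.
have [v vW fW] := first_set W0.
have z := diff_set [set v] [set v]; rewrite setDv in z.
have cc := comp_set v W.
have [C CE] : exists C, C = comp v W by exists (comp v W).
have vC : v \in C by rewrite CE mem_comp.
have C0 : C != set0 by apply/set0Pn; exists v.
have CW : C \subset W by rewrite CE comp_sub.
have [U [tU UC bU aU]] := separator_set C0.
have U0 : U != set0 by move: bU; rewrite CE; apply: balanced_neq0.
rewrite -CE in cc.
have o := or_set U B.
have d1 := diff_set C U; have d2 := diff_set W C.
have cC : #|U| + #|C :\: U| = #|C| by rewrite -(cardsID U C) (setIidPr UC).
have cW : #|C| + #|W :\: C| = #|W| by rewrite -(cardsID C W) (setIidPr CW).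
have U1 : 0 < #|U| by rewrite card_gt0.
have dis2 : [disjoint B & W :\: C].
  by apply: disjointWr BW; apply: subsetDl.
have dis1 : [disjoint U :|: B & C :\: U].
  rewrite disjoints_subset subUset; apply/andP; split; apply/subsetP => x.
    by rewrite !inE => ->.
  by move=> xB; rewrite !inE negb_and (contraFN (subsetP CW x)) ?orbT // (disjointFr BW).
have [lt2 lt1] : #|W :\: C| < n /\ #|C :\: U| < n by clear -Wn cC cW U1; lia.
have [bs2 [rec2 lay2 al2]] := IH (W :\: C) B acc lt2 dis2.
have [bs1 [rec1 lay1 al1]] := IH (C :\: U) (U :|: B) (bs2 ++ acc) lt1 dis1.
exists (U :|: B :: bs1 ++ bs2); split.
- have tz : css [:: set0] = cs (set0 : {set G}) :o: Nil by [].
  rewrite tz in tU; exec decompose_body; first by rewrite /= -catA.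
  have : Q + (Q * (2 * #|C :\: U|).+1 + Q * (2 * #|W :\: C|).+1) <= Q * (2 * #|W|).+1.
    by rewrite -mulnDr -mulnS leq_mul2l; apply/orP; right; clear -cC cW U1; lia.
  apply: leq_trans; have [] := cost_atoms.
  move: (Q * (2 * #|C :\: U|).+1) (Q * (2 * #|W :\: C|).+1) => x y.
  by move: N (N * N * N) (_ * S.+1) => a b c; clear; lia.
- apply: (layout_cons (C := C)) => // x y xC xy yW; by move: xC; rewrite CE => xC; apply: comp_closed xC xy yW.
- move=> m Wm; have Cm : #|C| <= m by rewrite CE; apply: Wm.
  have C1 : 0 < #|C| by rewrite card_gt0.
  have gC := leq_trans (g_half C1 (_ : #|C|./2.*2 <= #|C|)) (g_mono Cm).
  have {gC} gC : sz #|C| + g #|C|./2 <= g m by apply: gC; clear; lia.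
  have aUB := alpha_setU U B.
  move=> X; rewrite in_cons mem_cat => /orP[/eqP ->|/orP[X1|X2]]; first by clear -aUB aU gC; lia.
    have half u : u \in C :\: U -> #|comp u (C :\: U)| <= #|C|./2.
      by move=> uCU; have := balancedP _ _ bU u uCU; clear; lia.
    by have := al1 _ half X X1; clear -aUB aU gC; lia.
  apply: al2 X2 => u uWC; have uW : u \in W by move: uWC; rewrite inE => /andP[].
  by rewrite CE comp_setD -?CE //; apply: Wm.
Qed.

End DecomposeProgram.

(** * Paths as trees *)

Definition path_rel : rel nat := fun i j => (i.+1 == j) || (j.+1 == i).

Section PathGraph.
Variable m : nat.

Definition path_edge : rel 'I_m := fun i j => path_rel i j.

Lemma path_edge_sym : symmetric path_edge.
Proof. by move=> i j; rewrite /path_edge /path_rel orbC. Qed.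

Lemma path_edge_irr : irreflexive path_edge.
Proof. by move=> i; rewrite /path_edge /path_rel orbb; apply/eqP; lia. Qed.

Definition path_graph : sgraph := SGraph path_edge_sym path_edge_irr.

End PathGraph.

Lemma connect_ladder (T : finType) (e : rel T) (f : T -> nat) :
  connect_sym e -> injective f -> (forall x y, f y = (f x).+1 -> e x y) ->
  (forall x y k, f x <= k <= f y -> exists z, f z = k) ->
  forall x y, connect e x y.
Proof.
move=> esym finj step convex.
suff up x y : f x <= f y -> connect e x y.
  by move=> x y; have [/up //|/ltnW/up] := leqP (f x) (f y); rewrite esym.
have [n] := ubnP (f y - f x); elim: n x => // n IH x; rewrite ltnS => xyn xy.
have [eq_xy|lt_xy] := eqVneq (f x) (f y); first by rewrite (finj _ _ eq_xy) connect0.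
have [|z fz] := convex x y (f x).+1; first by lia.
apply: connect_trans (connect1 (step x z fz)) (IH z _ _); lia.
Qed.

Lemma path_graph_tree m : 0 < m -> is_tree (path_graph m).
Proof.
move=> m0; split; first by rewrite card_ord.
  apply: connect_ladder (val) _ val_inj _ _ => [|x y xy|x y k /andP[xk ky]].
  - exact/sym_connect_sym/(@edge_sym (path_graph m)).
  - by rewrite /edge /= /path_edge /path_rel xy eqxx.
  - by exists (Ordinal (leq_ltn_trans ky (ltn_ord y))).
(* Both neighbours of the largest node of a cycle would be its predecessor. *)
move=> p p2 /andP[cyc up].
have [i ip imax] : exists2 i, i \in p & forall j, j \in p -> (j : 'I_m) <= (i : 'I_m).
  case: p p2 {cyc up} => // x p _.
  have [i ip imax] := @arg_maxnP _ x (fun j => j \in x :: p) (@nat_of_ord m) (mem_head x p).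
  by exists i.
have [k q rotq] := rot_to ip.
have {cyc} cyc : cycle (@edge (path_graph m)) (i :: q) by rewrite -rotq rot_cycle.
have {up} uq : uniq (i :: q) by rewrite -rotq rot_uniq.
have {p2} q2 : 2 < size (i :: q) by rewrite -rotq size_rot.
have {imax rotq} imax j : j \in q -> (j : 'I_m) <= (i : 'I_m).
  by move=> jq; apply: imax; rewrite -(mem_rot k) rotq inE jq orbT.
case/lastP: q => [|q l] // in cyc uq q2 imax; case: q => [|j q] // in cyc uq q2 imax.
move: cyc; rewrite /= rcons_path last_rcons => /and3P[ij _ li].
have jl : j = l.
  have jm : (j : 'I_m) <= (i : 'I_m) by apply: imax; rewrite mem_head.
  have lm : (l : 'I_m) <= (i : 'I_m) by apply: imax; rewrite mem_rcons mem_head.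
  apply: val_inj; move: ij li; rewrite /edge /= /path_edge /path_rel /=.
  by move=> /orP[] /eqP ? /orP[] /eqP ?; lia.
by move: uq; rewrite /= jl mem_rcons mem_head andbF.
Qed.

Lemma code_seq_map (T T' : Type) (h : T' -> T) (f : T -> data) l :
  code_seq f (map h l) = code_seq (f \o h) l.
Proof. by elim: l => //= x l ->. Qed.

Lemma eq_code_seq (T : eqType) (f h : T -> data) l :
  {in l, f =1 h} -> code_seq f l = code_seq h l.
Proof.
elim: l => //= x l IH fh; rewrite fh ?mem_head // IH // => y yl.
by apply: fh; rewrite inE yl orbT.
Qed.

(** Adjacency matrices of paths indexed by plain numbers, which can be shifted
   in the induction that [path_rows_step] serves. *)
Definition path_rows (l1 l2 : seq nat) : data :=
  code_seq (fun i => code_seq (fun j => code_bool (path_rel i j)) l2) l1.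

Lemma code_path_graph m : code_graph (path_graph m) = path_rows (iota 0 m) (iota 0 m).
Proof.
rewrite /path_rows -val_enum_ord code_seq_map; apply: eq_code_seq => i _.
by rewrite /= code_seq_map; apply: eq_code_seq => j _; rewrite inE.
Qed.

Lemma path_rows_step m : path_rows (iota 0 m.+2) (iota 0 m.+2) =
  (Nil :o: code_bool true :o: code_seq (fun _ => Nil) (iota 1 m)) :o:
  (code_bool true :o: code_seq (fun j => code_bool (path_rel 0 j)) (iota 0 m.+1)) :o:
  code_seq (fun i => Nil :o: code_seq (fun j => code_bool (path_rel i j)) (iota 0 m.+1)) (iota 1 m).
Proof.
have i1 : iota 1 m.+1 = map succn (iota 0 m.+1) by rewrite -(iotaDl 1 0).
have i2 : iota 2 m = map succn (iota 1 m) by rewrite -(iotaDl 1 1).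
rewrite /path_rows (_ : iota 0 m.+2 = [:: 0, 1 & iota 2 m]) //.
rewrite [in LHS]/= -/(code_seq _ _) i2 !code_seq_map.
congr (Cons _ (Cons _ _)) => //.
  congr (Nil :o: code_bool true :o: _); apply: eq_code_seq => j; rewrite mem_iota => /andP[j0 _].
  by rewrite /path_rel /=; case: j j0.
apply: eq_code_seq => i; rewrite mem_iota => /andP[i0 _] /=.
by rewrite -/(code_seq _ _) code_seq_map /path_rel /=; case: i i0.
Qed.

Lemma ones_spec (T : Type) (r : T -> data) l :
  fn Ones (code_seq r l) (code_seq (fun _ => code_bool true) l) (20 * (size l).+1).
Proof. by elim: l => [|x l IH]; execute ones_body. Qed.

Lemma zeros_spec (T : Type) (r : T -> data) l :
  fn Zeros (code_seq r l) (code_seq (fun _ => Nil) l) (20 * (size l).+1).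
Proof. by elim: l => [|x l IH]; execute zeros_body. Qed.

Lemma pad_spec (T : Type) (r : T -> data) l :
  fn Pad (code_seq r l) (code_seq (fun i => Nil :o: r i) l) (20 * (size l).+1).
Proof. by elim: l => [|x l IH]; execute pad_body. Qed.

Lemma pathmatrix_spec (T : Type) (r : T -> data) l :
  fn PathMatrix (code_seq r l) (code_graph (path_graph (size l)))
    (100 * ((size l).+1 * (size l).+1)).
Proof.
rewrite code_path_graph; elim: l => [|x l IH]; first by execute pathmatrix_body.
case: l IH => [|x' l] IH; first by rewrite /path_rows [code_seq _ (iota 0 _)]/= in IH; execute pathmatrix_body.
have rows_cons n c : path_rows (iota 0 n.+1) c =
  code_seq (fun j => code_bool (path_rel 0 j)) c :o: path_rows (iota 1 n) c by [].
rewrite [size _]/= rows_cons in IH.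
have z := zeros_spec (fun i => code_seq (fun j => code_bool (path_rel i j)) (iota 0 (size l).+1)) (iota 1 (size l)).
have p := pad_spec (fun i => code_seq (fun j => code_bool (path_rel i j)) (iota 0 (size l).+1)) (iota 1 (size l)).
rewrite size_iota in z p.
rewrite [size (x :: _)]/= path_rows_step; execute pathmatrix_body.
Qed.

Section PathDecomposition.
Variable G : sgraph.
Implicit Types (bs : seq {set G}).

Lemma interval_nth v bs : interval_of v bs ->
  exists a b, forall i, (v \in nth set0 bs i) = (a <= i <= b).
Proof.
move=> [a [b [c E]]]; exists a, (a + b) => i.
have -> : (v \in nth set0 bs i) = nth false [seq v \in X | X : {set G} <- bs] i.
  have [ib|ib] := ltnP i (size bs); first by rewrite (nth_map set0).
  by rewrite !nth_default ?size_map ?in_set0.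
rewrite E !nth_cat !nth_nseq !size_nseq; clear E.
by do ![case: ifP]; lia.
Qed.

Lemma layout_decomp bs : 0 < #|G| -> layout setT set0 bs ->
  exists D : tree_decomp G, [/\
    code_decomp D = Cons (code_graph (path_graph (size bs))) (code_seq (@code_set G) bs),
    #|td_tree D| = size bs &
    forall k, (forall X, X \in bs -> alpha_set X <= k) -> td_alpha D <= k].
Proof.
move=> /card_gt0P[v0 _] [_ int edg _].
pose T := path_graph (size bs); pose bag (t : T) := nth set0 bs t.
have bagP X : X \in bs -> exists t, bag t = X.
  move=> Xbs; have ix : index X bs < size bs by rewrite index_mem.
  by exists (Ordinal ix); rewrite /bag /= nth_index.
have occ v : exists t, v \in bag t.
  have [a [b [c E]]] := int v (in_setT _).
  have : true \in [seq v \in X | X : {set G} <- bs] by rewrite E !mem_cat mem_head orbT.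
  by move=> /mapP[X /bagP[t <-] vX]; exists t.
have occE u v : edge u v -> exists t, (u \in bag t) && (v \in bag t).
  by move=> uv; have [X /bagP[t <-]] := edg u v (in_setT _) (in_setT _) uv; exists t.
have bs0 : 0 < size bs by have [[i ib] _] := occ v0; apply: leq_ltn_trans ib.
have conn v : connected (induced [set t | v \in bag t]).
  have [a [b H]] := interval_nth (int v (in_setT _)).
  apply: (@connect_ladder _ _ (fun x => val (val x))) => [||x y xy|x y k /andP[xk ky]].
  - exact/sym_connect_sym/(@edge_sym (induced [set t : T | v \in bag t])).
  - exact: inj_comp val_inj val_inj.
  - by rewrite /edge /= /induced_edge /edge /= /path_edge /path_rel xy eqxx.
  - have kb : k < size bs := leq_ltn_trans ky (ltn_ord (val y)).
    have kS : (Ordinal kb : T) \in [set t | v \in bag t].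
      have inS (z : induced [set t : T | v \in bag t]) : a <= val (val z) <= b.
        by rewrite -H; have := valP z; rewrite inE.
      have /andP[ax _] := inS x; have /andP[_ yb] := inS y.
      by rewrite inE /bag H /= (leq_trans ax xk) (leq_trans ky yb).
    by exists (Sub (Ordinal kb : T) kS).
exists (TreeDecomp (path_graph_tree bs0) occ occE conn); split.
- rewrite /code_decomp /=; congr Cons.
  rewrite -[in RHS](mkseq_nth set0 bs) /mkseq -val_enum_ord -map_comp.
  by rewrite code_seq_map.
- by rewrite card_ord.
- move=> k bsk; apply/bigmax_leqP => t _; rewrite alpha_induced; apply: bsk.
  exact: mem_nth.
Qed.

End PathDecomposition.

(** * The whole program *)

Section MainProgram.
Variables (G : sgraph) (sz g : nat -> nat) (S : nat).
Hypothesis G0 : 0 < #|G|.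
Hypothesis sepG : forall K : {set G}, K != set0 -> separable K (sz #|K|).
Hypothesis sz_max : forall k, k <= #|G| -> sz k <= S.
Hypothesis g_mono : {homo g : k m / k <= m}.
Hypothesis g_half : forall k m, 0 < k -> m.*2 <= k -> sz k + g m <= g k.

Local Notation N := (#|G|.+1).
Local Notation cs := (@code_set G).
Local Notation css := (code_seq (@code_set G)).
Local Notation cg := (code_graph G).
Local Notation P := (N ^ S).

(** The factor [S.+1] is at most [P] and the constants at most [2 ^ 16], hence
   [N ^ 16]. *)
Lemma main_cost x : x <= 100 * (N * N) ->
  7 * 1500 * (N * N * N * N * (P * P) * S.+1) * (2 * #|G|).+1 + x + 100 * N
    <= N ^ (3 * S + 21).
Proof.
move=> xN.
have N2 : 2 <= N by rewrite ltnS.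
have SP : S.+1 <= P by apply: ltn_expl.
pose W := N * N * N * N * (P * P) * P * N.
have WE : N ^ (3 * S + 21) = N ^ 16 * W.
  rewrite (_ : 3 * S + 21 = 16 + (1 + 1 + 1 + 1 + (S + S) + S + 1)); last by lia.
  by rewrite !expnD !expn1.
have NW : N * N <= W.
  by rewrite /W leq_mul2r -!mulnA leq_pmulr // !muln_gt0 N_exp.
have big : 7 * 1500 * (N * N * N * N * (P * P) * S.+1) * (2 * #|G|).+1 <= 7 * 1500 * (2 * W).
  rewrite -[leqLHS]mulnA leq_mul2l; apply/orP; right.
  rewrite /W [leqRHS]mulnCA leq_mul //; first exact: leq_mul.
  by clear; lia.
have N16 : 2 ^ 16 <= N ^ 16 by rewrite leq_exp2r.
have NN : N <= N * N by rewrite leq_pmulr.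
rewrite WE; apply: leq_trans (leq_mul N16 (leqnn W)).
have c16 : 22 * 1000 <= 2 ^ 16 by [].
apply: leq_trans (leq_mul c16 (leqnn W)).
have NW' := leq_trans NN NW.
apply: leq_trans (leq_add (leq_add big xN) (leqnn _)) _.
by clearbody W; clear -NW NW'; move: (N * N) N NW NW' => a b; lia.
Qed.

Lemma main_spec : exists (D : tree_decomp G) (t : nat),
  [/\ runs prog (code_graph G) (code_decomp D) t, t <= N ^ (3 * S + 21),
      #|td_tree D| <= #|G| & td_alpha D <= g #|G|].
Proof.
have dis : [disjoint (set0 : {set G}) & [set: G]] by apply/pred0P => x; rewrite /= in_set0.
have [bs []] := decompose_set G0 sepG sz_max g_mono g_half [::] dis.
rewrite cats0 cardsT => dec lay al.
have [D [cD sD aD]] := layout_decomp G0 lay.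
have pm := pathmatrix_spec (@code_set G) bs.
have o := ones_spec (fun x : G => cs [set y | edge x y]) (enum G).
have z := zeros_spec (fun x : G => cs [set y | edge x y]) (enum G).
rewrite -cardE in o z.
have oE : code_seq (fun _ => code_bool true) (enum G) = cs [set: G].
  by apply: eq_code_seq => x _; rewrite in_setT.
have zE : code_seq (fun _ => Nil) (enum G) = cs (set0 : {set G}).
  by apply: eq_code_seq => x _; rewrite in_set0.
rewrite oE in o; rewrite zE in z.
have sbs : size bs <= #|G| by have := layout_size lay; rewrite cardsT.
have : fn 0 cg (code_decomp D) (N ^ (3 * S + 21)).
  rewrite cD; exec main_body => //.
  have x_le : 100 * ((size bs).+1 * (size bs).+1) <= 100 * (N * N) by rewrite !leq_mul.
  apply: leq_trans (main_cost x_le).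
  have : 0 < N by []; clear.
  by move: N (_ * (2 * #|G|).+1) (100 * (_ * _)) => n a b; lia.
move=> [t run_t tT]; exists D, t; split=> //; first by rewrite sD.
apply: aD => X Xbs; have := al #|G| _ X Xbs; rewrite alpha_set0; apply.
by move=> v _; apply: max_card.
Qed.

End MainProgram.

(** * Real estimates *)

Section Estimates.
Variables (R : realType) (c e : R).
Local Open Scope ring_scope.
Hypothesis ce : [/\ 1 <= c, 0 < e & e <= 1].

(** Here [c] and [e] are the constants of the class.  With [x = k^(1 - e / 2)],
   an induced subgraph on [k] vertices gets a separator of independence number
   at most [3 c x] and bags of at most [12 c x]: the factor [4] pays for the
   geometric series of ratio [2^-(1 - e / 2) <= 3 / 4]. *)
Definition sep_size (k : nat) : nat := Num.truncn (3 * c * k%:R `^ (1 - e / 2)).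
Definition bag_alpha (k : nat) : nat := Num.truncn (12 * c * k%:R `^ (1 - e / 2)).

Lemma powR_nat_ge1 (n : nat) (x : R) : (0 < n)%N -> 0 <= x -> 1 <= n%:R `^ x.
Proof.
move=> n0 x0; have n1 : 1 <= n%:R :> R by rewrite ler1n.
by have := ler_powR n1 x0; rewrite powRr0.
Qed.

Lemma powR_nat_mono (n : nat) (x y : R) : (0 < n)%N -> x <= y -> n%:R `^ x <= n%:R `^ y.
Proof. by move=> n0; apply: ler_powR; rewrite ler1n. Qed.

Lemma scaled_powR_ge0 (t : R) (n : nat) (x : R) : 0 <= t -> 0 <= t * c * n%:R `^ x.
Proof.
have [c1 e0 e1] := ce.
move=> t0; apply: mulr_ge0 (powR_ge0 _ _); apply: mulr_ge0 t0 _.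
by lra.
Qed.

Lemma powR_half (k m : nat) : (m.*2 <= k)%N ->
  m%:R `^ (1 - e / 2) <= 3 / 4 * k%:R `^ (1 - e / 2).
Proof.
have [c1 e0 e1] := ce.
move=> mk; have mk' : m%:R <= 2^-1 * k%:R :> R.
  by rewrite -(ler_nat R) -mul2n natrM in mk; lra.
apply: le_trans (_ : (2^-1 * k%:R) `^ (1 - e / 2) <= _).
  by apply: ge0_ler_powR; rewrite ?nnegrE ?ler0n //; [lra | by rewrite mulr_ge0 ?invr_ge0 ?ler0n].
rewrite powRM ?ler0n //; last by lra.
apply: ler_wpM2r; first exact: powR_ge0.
apply: le_trans (_ : 2^-1 `^ (2^-1) <= _).
  by apply: ger_powR; lra.
rewrite powR12_sqrt; last by lra.
have s0 := @sqrtr_ge0 R 2^-1; have s2 : Num.sqrt 2^-1 ^+ 2 = 2^-1 :> R by rewrite sqr_sqrtr //; lra.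
by nra.
Qed.

Lemma bag_alpha_half k m : (0 < k)%N -> (m.*2 <= k)%N ->
  (sep_size k + bag_alpha m <= bag_alpha k)%N.
Proof.
have [c1 e0 e1] := ce.
move=> k0 /powR_half mk.
have pk := powR_ge0 k%:R (1 - e / 2); have pm := powR_ge0 m%:R (1 - e / 2).
rewrite truncn_ge_nat ?scaled_powR_ge0 // natrD.
have : (sep_size k)%:R <= 3 * c * k%:R `^ (1 - e / 2) by rewrite truncn_le scaled_powR_ge0.
have : (bag_alpha m)%:R <= 12 * c * m%:R `^ (1 - e / 2) by rewrite truncn_le scaled_powR_ge0.
have c0 : 0 <= c by lra.
by have := ler_wpM2l c0 mk; rewrite -!mulrA; lra.
Qed.

Lemma bag_alpha_mono : {homo bag_alpha : k m / (k <= m)%N}.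
Proof.
have [c1 e0 e1] := ce.
move=> k m km; apply: le_truncn; apply: ler_wpM2l; first by lra.
by apply: ge0_ler_powR; rewrite ?nnegrE ?ler0n ?ler_nat //; lra.
Qed.

Lemma sep_size_mono : {homo sep_size : k m / (k <= m)%N}.
Proof.
have [c1 e0 e1] := ce.
move=> k m km; apply: le_truncn; apply: ler_wpM2l; first by lra.
by apply: ge0_ler_powR; rewrite ?nnegrE ?ler0n ?ler_nat //; lra.
Qed.

(** The tree-independence number [k] is at most [c x] with [x = n^(1 - e / 2)],
   while [s = sep_size n] exceeds [2 c x]; so [s * (s - k) > 2 (c x)^2], and
   [x^2 = n * n^(1 - e)]. *)
Lemma sep_size_large (k n : nat) : (0 < n)%N -> k%:R <= c * n%:R `^ (1 - e) ->
  (k < sep_size n)%N /\ (k * n < sep_size n * (sep_size n - k))%N.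
Proof.
have [c1 e0 e1] := ce.
move=> n0 kn; set x := n%:R `^ (1 - e / 2).
have x1 : 1 <= x by apply: powR_nat_ge1 => //; lra.
have xx : x * x = n%:R * n%:R `^ (1 - e).
  have n_ne0 : n%:R != 0 :> R by rewrite pnatr_eq0 -lt0n.
  rewrite /x -powRD ?n_ne0 ?implybT // -[X in X * _ `^ (1 - e)](powRr1 (ler0n R n)).
  by rewrite -powRD ?n_ne0 ?implybT //; congr (_ `^ _); lra.
have kx : k%:R <= c * x.
  by apply: le_trans kn _; apply: ler_wpM2l; [lra | apply: powR_nat_mono => //; lra].
have sx : 3 * c * x < (sep_size n).+1%:R.
  by have /andP[] := truncn_itv (scaled_powR_ge0 n (1 - e / 2) (ler0n R 3)).
rewrite -[(sep_size n).+1]addn1 natrD in sx.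
have cx : 1 <= c * x by nra.
have ks : (k < sep_size n)%N by rewrite -(ltr_nat R); lra.
split=> //; rewrite -(ltr_nat R) !natrM natrB; last exact: ltnW.
have nn : 0 <= n%:R :> R by [].
apply: le_lt_trans (_ : c * (x * x) < _).
  by rewrite xx [_ * (n%:R * _)]mulrCA mulrC ler_wpM2l // mulrC.
have : 2 * (c * x) <= (sep_size n)%:R by lra.
have : c * x < (sep_size n)%:R - k%:R by lra.
move: ((sep_size n)%:R : R) => s h1 h2.
have xcx : x <= c * x by rewrite ler_peMl //; lra.
rewrite mulrA; apply: le_lt_trans (_ : c * x * (c * x) < _); first by apply: ler_wpM2l; lra.
by apply: ltr_pM; lra.
Qed.

(** The logarithm of [n + 1] is at most a constant times [n^(e / 4)]: this is
   what the passage from [1 - e / 2] to [1 - e / 4] pays for. *)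
Lemma runtime_bound : exists K : R, forall n : nat, (0 < n)%N ->
  (n.+1 ^ (3 * sep_size n + 21))%:R <= 2 `^ (K * n%:R `^ (1 - e / 4)) :> R.
Proof.
have [c1 e0 e1] := ce.
pose d := e / 4.
exists ((9 * c + 21) * (2 / d) / ln 2) => n n0.
have d0 : 0 < d by rewrite /d; lra.
have n1 : 1 <= n%:R :> R by rewrite ler1n.
have ln2 : 0 < ln (2 : R) by rewrite ln_gt0 //; lra.
have N0 : 0 < n.+1%:R :> R by rewrite ltr0n.
have lnN : ln n.+1%:R <= 2 / d * n%:R `^ d :> R.
  have : d * ln n.+1%:R <= n.+1%:R `^ d :> R.
    by rewrite -ln_powR; apply/ltW/ln_sublinear/powR_gt0.
  have : n.+1%:R `^ d <= 2 * n%:R `^ d :> R.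
    apply: le_trans (_ : (2 * n%:R) `^ d <= _).
      apply: ge0_ler_powR; [exact: ltW | by rewrite nnegrE ler0n | by rewrite nnegrE mulr_ge0 ?ler0n | ].
      by rewrite -(natr1 n); lra.
    rewrite powRM ?ler0n //; apply: ler_wpM2r; first exact: powR_ge0.
    by apply: ler1_powR; rewrite /d; lra.
  move=> h1 h2; rewrite mulrAC ler_pdivlMr //; lra.
have szn : (3 * sep_size n + 21)%:R <= (9 * c + 21) * n%:R `^ (1 - e / 2) :> R.
  have : (sep_size n)%:R <= 3 * c * n%:R `^ (1 - e / 2) :> R.
    by rewrite truncn_le scaled_powR_ge0.
  have : 1 <= n%:R `^ (1 - e / 2) :> R by apply: powR_nat_ge1 => //; lra.
  by rewrite natrD natrM; nra.
have pow : n%:R `^ (1 - e / 2) * n%:R `^ d = n%:R `^ (1 - e / 4) :> R.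
  rewrite -powRD; last by rewrite pnatr_eq0 -lt0n n0 implybT.
  by congr (_ `^ _); rewrite /d; lra.
rewrite natrX -ler_ln ?posrE ?powR_gt0 ?exprn_gt0 //.
rewrite ln_powR lnXn // -[leLHS]mulr_natl -pow.
rewrite [leRHS](_ : _ = (9 * c + 21) * n%:R `^ (1 - e / 2) * (2 / d * n%:R `^ d)); last by field; lra.
by apply: ler_pM => //; apply: ln_ge0; rewrite ler1n.
Qed.

End Estimates.

(** * The algorithm for a hereditary class *)

Lemma separable_of_balanced (G : sgraph) (K X : {set G}) k s : X \subset K ->
  balanced K X -> alpha_set X <= k -> k < s -> k * #|K| < s * (s - k) -> separable K s.
Proof.
move=> XK bX aX ks kK Js cJs.
have [F [FX cF keep]] := container_fingerprint aX ks cJs XK.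
exists F; split; first exact: subset_trans FX XK.
  have : #|F| * (s - k) < s * (s - k) := leq_ltn_trans cF kK.
  by rewrite ltn_mul2r => /andP[].
by apply: balancedS bX; apply: keep.
Qed.

Lemma induced_separable (G : sgraph) (K : {set G}) s :
  tree_alpha (induced K) < s ->
  tree_alpha (induced K) * #|K| < s * (s - tree_alpha (induced K)) -> separable K s.
Proof.
rewrite /tree_alpha; case: ex_minnP => k /asboolP[D Dk] _ ks kK.
have [X XK [bX aX]] := decomp_balanced_bag D.
by apply: separable_of_balanced XK bX _ ks kK; rewrite -Dk.
Qed.

Theorem corollary1p2 (R : realType) (C : sgraph -> Prop)
    (C_class : graph_class C)
    (C_hereditary : hereditary C)
    (C_sublinear : strongly_sublinear_tree_alpha R C) :
  exists c eps : R, [/\ (1 <= c)%R, (0 < eps)%R &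
    exists (p : program) (K : R), forall G : sgraph, C G ->
      exists (D : tree_decomp G) (t : nat),
        [/\ runs p (code_graph G) (code_decomp D) t,
            (t%:R <= 2 `^ (K * (#|G|%:R `^ (1 - eps))))%R,
            #|td_tree D| <= #|G| &
            ((td_alpha D)%:R <= c * (#|G|%:R `^ (1 - eps)))%R]].
Proof.
have [c [e' [c1 e'0 sub]]] := C_sublinear.
(* With [e <= 1] the exponents [1 - e / 2] and [1 - e / 4] are nonnegative. *)
pose e := Num.min e' 1%R.
have ce : [/\ 1 <= c, 0 < e & e <= 1]%R.
  by split=> //; rewrite /e ?lt_min ?e'0 ?ltr01 // ge_min lexx orbT.
have [K Kt] := runtime_bound ce.
exists (12 * c)%R, (e / 4)%R; split.
- by lra.
- by have [_ e0 _] := ce; lra.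
exists prog, K => G CG.
have G0 : 0 < #|G| by apply: C_class.1.
have sepG (K' : {set G}) : K' != set0 -> separable K' (sep_size c e #|K'|).
  move=> K0; have cK : 0 < #|K'| by rewrite card_gt0.
  have cardK : #|induced K'| = #|K'| by rewrite card_sig.
  have := sub _ (C_hereditary G K' K0 CG); rewrite cardK => subK.
  have [|ks kK] := sep_size_large ce (k := tree_alpha (induced K')) cK _.
    apply: le_trans subK _; apply: ler_wpM2l; first by lra.
    by apply: powR_nat_mono => //; rewrite lerB // /e ge_min lexx.
  exact: induced_separable ks kK.
have sz_max k : k <= #|G| -> sep_size c e k <= sep_size c e #|G| by apply: sep_size_mono.
have [D [t [run_t t_le sD aD]]] := main_spec G0 sepG sz_max (bag_alpha_mono ce) (bag_alpha_half ce).
exists D, t; split=> //.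
  by apply: le_trans (Kt #|G| G0); rewrite ler_nat.
have [_ e0 _] := ce.
apply: le_trans (_ : (bag_alpha c e #|G|)%:R <= _)%R; first by rewrite ler_nat.
apply: le_trans (_ : 12 * c * #|G|%:R `^ (1 - e / 2) <= _)%R.
  by rewrite truncn_le (scaled_powR_ge0 ce).
by apply: ler_wpM2l; [lra | apply: powR_nat_mono => //; lra].
Qed.
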